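(* Let $N=(0,\tau_{\max})\times M$ be a cosmological spacetime with compact slices, with metric $g=-dt^2+h$, such that $h$ extends continuously to $t=0$ and $t=\tau_{\max}$ as a Riemannian metric. Then the metric completion $(\bar N,\hat d_g)$ of the metric space $(N,\hat d_g)$ is compact. Moreover, for any fixed $t_0\in[0,\tau_{\max}]$, $(\bar N,\hat d_g)$ is bi-Lipschitz equivalent to the space $([0,\tau_{\max}]\times M,d)$, where $$d((t,x),(s,y))=|t-s|+d_{t_0}(x,y),$$ and $d_{t_0}$ is the distance induced on $M$ by the Riemannian metric $h_{t_0}=h|_{\{t_0\}\times M}$.
   Context: A spacetime is a connected smooth Lorentzian manifold $(N,g)$ of signature $(-,+,\dots,+)$ with a time orientation. A tangent vector $v$ is timelike if $g(v,v)<0$, null if $v\neq0$ and $g(v,v)=0$, causal if timelike or null. A cosmological spacetime is a spacetime $N=I\times M$ with $I$ a bounded open interval (here $I=(0,\tau_{\max})$) and $M$ a smooth manifold, whose metric splits as $g=-dt^2+h$, where $h=h_{(t,x)}$ is a smooth symmetric 2-tensor on $N$ whose radical is spanned by $\partial_t$ (i.e. $h(\partial_t,v)=0$ for all $v\in TN$); consequently each restriction $h_t$ of $h$ to $\{t\}\times M\cong M$ is a Riemannian metric. It is time-oriented by $\partial_t$. It has compact slices if $M$ is compact. ''$h$ extends continuously to $t=0$ and $t=\tau_{\max}$ as a Riemannian metric'' means that the family $h_t$ extends to a family defined for $t\in[0,\tau_{\max}]$, continuous in $(t,x)$, with $h_0$ and $h_{\tau_{\max}}$ (continuous) Riemannian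 metrics on $M$. A piecewise causal curve is a continuous curve $\alpha:[a,b]\to N$ admitting a partition $a=s_0<\dots<s_n=b$ with each $\alpha|_{(s_{i-1},s_i)}$ smooth and causal (different segments may be future or past directed). Its null length with respect to the time function $\tau(t,x)=t$ is $\hat L(\alpha)=\sum_{i=1}^n|\tau(\alpha(s_i))-\tau(\alpha(s_{i-1}))|$. The null distance $\hat d_g(p,q)$ is the infimum of $\hat L(\alpha)$ over all piecewise causal curves from $p$ to $q$. (The function $t$ is the cosmological time of $N$, and in this setting $\hat d_g$ is a genuine distance.) *)

(* Defs.v *)
From mathcomp Require Import all_boot all_order all_algebra.
From mathcomp Require Import all_classical all_reals all_analysis.

Set Implicit Arguments.
Unset Strict Implicit.
Unset Printing Implicit Defensive.

Import Order.TTheory GRing.Theory Num.Theory.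
Import numFieldNormedType.Exports.

Local Open Scope classical_set_scope.
Local Open Scope ring_scope.

(* Only meant for open [U] and finite-dimensional [V], where asking for all
   directional derivatives to be C^k is the usual recursive definition. *)
Fixpoint Ck (R : realType) (V W : normedModType R) (k : nat) (U : set V)
    (f : V -> W) : Prop :=
  match k with
  | 0 => forall x, U x -> {for x, continuous f}
  | k'.+1 => (forall x, U x -> differentiable f x) /\
             (forall v : V, Ck k' U (fun x => 'D_v f x))
  end.

Definition smooth_on (R : realType) (V W : normedModType R) (U : set V)
    (f : V -> W) : Prop :=
  forall k, Ck k U f.

(* Charts modelled on [E].  [chart i] and its inverse [param i] are total
   functions, meaningful on [dom i] and on [chart i @` dom i] only.  [chart_at]
   selects a chart around each point; it serves only to write down numbers
   (such as speeds) that do not depend on the chart. *)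
Record atlas (R : realType) (E : normedModType R) (P : topologicalType) := Atlas {
  chart_index : Type;
  dom : chart_index -> set P;
  chart : chart_index -> P -> E;
  param : chart_index -> E -> P;
  chart_at : P -> chart_index }.

Arguments chart_index {R E P}.
Arguments dom {R E P}.
Arguments chart {R E P}.
Arguments param {R E P}.
Arguments chart_at {R E P}.

Record smooth_manifold (R : realType) (E : normedModType R)
    (P : topologicalType) (A : atlas E P) : Prop := SmoothManifold {
  manifold_hausdorff : hausdorff_space P;
  manifold_second_countable : @second_countable P;
  manifold_cover : forall p, dom A (chart_at A p) p;
  manifold_open_dom : forall i, open (dom A i);
  manifold_open_img : forall i, open (chart A i @` dom A i);
  manifold_chartK : forall i p, dom A i p -> param A i (chart A i p) = p;
  manifold_chart_cont : forall i p, dom A i p -> {for p, continuous (chart A i)};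
  manifold_param_cont : forall i y, (chart A i @` dom A i) y ->
    {for y, continuous (param A i)};
  manifold_transition : forall i j,
    smooth_on (chart A i @` (dom A i `&` dom A j)) (chart A j \o param A i) }.

(* The product atlas on the open subset [I `*` setT] of [R * M]; tangent vectors
   are pairs (dt-component, component along M), and d/dt is [(1, 0)]. *)
Definition product_atlas (R : realType) (E : normedModType R)
    (M : topologicalType) (I : set R) (A : atlas E M) :
    atlas (R * E)%type (R * M)%type :=
  @Atlas R (R * E)%type (R * M)%type (chart_index A)
    (fun i => I `*` dom A i)
    (fun i p => (p.1, chart A i p.2))
    (fun i y => (y.1, param A i y.2))
    (fun p => chart_at A p.2).

(* A covariant 2-tensor given by its representatives: [T i p] is the bilinear
   form at [p], read in the chart [i]; it is irrelevant outside [dom i]. *)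
Definition tensor2 (R : realType) (E : normedModType R) (P : topologicalType)
    (A : atlas E P) : Type :=
  chart_index A -> P -> E -> E -> R.

Record symmetric_tensor2 (R : realType) (E : normedModType R)
    (P : topologicalType) (A : atlas E P) (T : tensor2 A) : Prop :=
  SymmetricTensor2 {
  tensor2_linear : forall i p, dom A i p -> forall (a : R) (u v w : E),
    T i p (a *: u + v) w = a * T i p u w + T i p v w;
  tensor2_sym : forall i p, dom A i p -> forall v w : E, T i p v w = T i p w v;
  tensor2_transition : forall i j p, dom A i p -> dom A j p -> forall v w : E,
    T i p v w = T j p ('d (chart A j \o param A i) (chart A i p) v)
                      ('d (chart A j \o param A i) (chart A i p) w) }.

Definition smooth_tensor2 (R : realType) (E : normedModType R)
    (P : topologicalType) (A : atlas E P) (T : tensor2 A) : Prop :=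
  forall i (v w : E),
    smooth_on (chart A i @` dom A i) (fun y => T i (param A i y) v w).

Record continuous_riemannian_metric (R : realType) (E : normedModType R)
    (P : topologicalType) (A : atlas E P) (T : tensor2 A) : Prop :=
  ContinuousRiemannianMetric {
  riem_tensor : symmetric_tensor2 T;
  riem_continuous : forall i (v w : E) p, dom A i p ->
    {for p, continuous (fun q => T i q v w)};
  riem_posdef : forall i p, dom A i p -> forall v : E, v != 0 -> 0 < T i p v v }.

Definition smooth_curve (R : realType) (E : normedModType R)
    (P : topologicalType) (A : atlas E P) (J : set R) (c : R -> P) : Prop :=
  [/\ forall s, J s -> dom A (chart_at A (c s)) (c s),
      forall s, J s -> {for s, continuous c}
    & forall i, smooth_on (J `&` c @^-1` dom A i) (chart A i \o c)].

Definition velocity (R : realType) (E : normedModType R) (P : topologicalType)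
    (A : atlas E P) (i : chart_index A) (c : R -> P) (s : R) : E :=
  'D_1 (chart A i \o c) s.

Definition is_partition (R : realType) (a b : R) (n : nat) (s : nat -> R) : Prop :=
  [/\ a < b, s 0%N = a, s n = b & forall k, (k < n)%N -> s k < s k.+1].

Definition riem_speed (R : realType) (E : normedModType R)
    (P : topologicalType) (A : atlas E P) (T : tensor2 A) (c : R -> P) (s : R) : R :=
  let i := chart_at A (c s) in
  Num.sqrt (T i (c s) (velocity i c s) (velocity i c s)).

(* Smoothness on a closed segment is meant as the existence of a smooth
   extension to a larger open interval. *)
Record piecewise_smooth (R : realType) (E : normedModType R)
    (P : topologicalType) (A : atlas E P) (a b : R) (c : R -> P) : Prop :=
  PiecewiseSmooth {
  psmooth_continuous : {within `[a, b], continuous c};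
  psmooth_segments : exists n s, is_partition a b n s /\
    forall k, (k < n)%N -> exists (e : R) (c' : R -> P),
      [/\ 0 < e, smooth_curve A `]s k - e, s k.+1 + e[ c'
        & forall u, s k <= u <= s k.+1 -> c u = c' u] }.

Definition riem_length (R : realType) (E : normedModType R)
    (P : topologicalType) (A : atlas E P) (T : tensor2 A) (a b : R) (c : R -> P) :
    \bar R :=
  (\int[lebesgue_measure]_(s in `[a, b]) (riem_speed T c s)%:E)%E.

Definition riem_dist (R : realType) (E : normedModType R)
    (P : topologicalType) (A : atlas E P) (T : tensor2 A) (x y : P) : \bar R :=
  ereal_inf [set l | exists (a b : R) (c : R -> P),
    [/\ piecewise_smooth A a b c, c a = x, c b = y & l = riem_length T a b c]].

Definition timelike (R : realType) (E : normedModType R) (g : E -> E -> R)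
    (v : E) : Prop := g v v < 0.

Definition null (R : realType) (E : normedModType R) (g : E -> E -> R)
    (v : E) : Prop := v <> 0 /\ g v v = 0.

Definition causal (R : realType) (E : normedModType R) (g : E -> E -> R)
    (v : E) : Prop := timelike g v \/ null g v.

(* Signature (-,+,...,+) in dimension n+1: a pseudo-orthonormal basis (n+1
   spanning vectors with a nondegenerate Gram matrix are a basis). *)
Definition lorentz_signature (R : realType) (E : normedModType R) (n : nat)
    (g : E -> E -> R) : Prop :=
  exists e : 'I_n.+1 -> E,
    (forall v, exists a : 'I_n.+1 -> R, v = \sum_i a i *: e i) /\
    (forall i j, g (e i) (e j) =
       if i == j then (if i == ord0 then -1 else 1) else 0).

(* A [smooth_curve] stays in the union of the chart domains; the last clause of
   [pcausal_in] is needed for the partition points. *)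
Record piecewise_causal (R : realType) (E : normedModType R)
    (P : topologicalType) (A : atlas E P) (g : tensor2 A)
    (a b : R) (n : nat) (s : nat -> R) (c : R -> P) : Prop := PiecewiseCausal {
  pcausal_partition : is_partition a b n s;
  pcausal_in : forall u, a <= u <= b -> dom A (chart_at A (c u)) (c u);
  pcausal_continuous : {within `[a, b], continuous c};
  pcausal_smooth : forall k, (k < n)%N -> smooth_curve A `]s k, s k.+1[ c;
  pcausal_causal : forall k, (k < n)%N -> forall u, s k < u < s k.+1 ->
    forall i, dom A i (c u) -> causal (g i (c u)) (velocity i c u) }.

Definition null_length (R : realType) (P : Type) (tau : P -> R) (n : nat)
    (s : nat -> R) (c : R -> P) : R :=
  \sum_(k < n) `|tau (c (s k.+1)) - tau (c (s k))|.

Definition null_dist (R : realType) (E : normedModType R)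
    (P : topologicalType) (A : atlas E P) (g : tensor2 A) (tau : P -> R)
    (p q : P) : \bar R :=
  ereal_inf [set l | exists (a b : R) (n : nat) (s : nat -> R) (c : R -> P),
    [/\ piecewise_causal g a b n s c, c a = p, c b = q
      & l = (null_length tau n s c)%:E]].

Section Cosmological.
Context (R : realType) (n : nat) (M : topologicalType) (A : atlas 'rV[R]_n M)
  (tmax : R).

(* The charts of N = (0,tmax) x M. *)
Definition cosmo_atlas : atlas (R * 'rV[R]_n)%type (R * M)%type :=
  product_atlas `]0, tmax[ A.

Definition cosmo_space : set (R * M) := `]0, tmax[ `*` setT.

(* g = - dt^2 + h *)
Definition cosmo_metric (h : tensor2 cosmo_atlas) : tensor2 cosmo_atlas :=
  fun i p v w => - (v.1 * w.1) + h i p v w.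

Record cosmological_spacetime (h : tensor2 cosmo_atlas) : Prop :=
  CosmologicalSpacetime {
  cosmo_tmax : 0 < tmax;
  cosmo_manifold : smooth_manifold A;
  cosmo_connected : connected cosmo_space;
  cosmo_tensor : symmetric_tensor2 h;
  cosmo_smooth : smooth_tensor2 h;
  cosmo_radical : forall i p, dom cosmo_atlas i p ->
    forall v : R * 'rV[R]_n,
      (forall w, h i p v w = 0) <-> (exists a : R, v = a *: (1, 0));
  cosmo_lorentzian : forall i p, dom cosmo_atlas i p ->
    lorentz_signature n (cosmo_metric h i p) }.

(* [hbar t], for 0 <= t <= tmax, is the extended family of slice tensors. *)
Record extends_continuously (h : tensor2 cosmo_atlas) (hbar : R -> tensor2 A) :
    Prop := ExtendsContinuously {
  ext_agree : forall t, 0 < t < tmax -> forall i x, dom A i x ->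
    forall v w : 'rV[R]_n, hbar t i x v w = h i (t, x) (0, v) (0, w);
  ext_continuous : forall i (v w : 'rV[R]_n),
    {within `[0, tmax] `*` dom A i,
      continuous (fun p : R * M => hbar p.1 i p.2 v w)};
  ext_riem0 : continuous_riemannian_metric (hbar 0);
  ext_riem_tmax : continuous_riemannian_metric (hbar tmax) }.

Definition cosmo_null_dist (h : tensor2 cosmo_atlas) : R * M -> R * M -> \bar R :=
  null_dist (cosmo_metric h) fst.

Definition product_dist (hbar : R -> tensor2 A) (t0 : R) (p q : R * M) : \bar R :=
  (`|p.1 - q.1|%:E + riem_dist (hbar t0) p.2 q.2)%E.

End Cosmological.

Arguments cosmo_space {R} M tmax.

Record is_metric_on (R : realType) (P : Type) (N : set P) (d : P -> P -> \bar R) :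
    Prop := IsMetricOn {
  metric_on_fin : forall p q, N p -> N q -> d p q \is a fin_num;
  metric_on_ge0 : forall p q, N p -> N q -> (0 <= d p q)%E;
  metric_on_eq0 : forall p q, N p -> N q -> (d p q = 0%E <-> p = q);
  metric_on_sym : forall p q, N p -> N q -> d p q = d q p;
  metric_on_triangle : forall p q r, N p -> N q -> N r ->
    (d p r <= d p q + d q r)%E }.

(* [X], with the isometric embedding [iota] of [N], is a metric completion of
   (N, d); it is unique up to isometry. *)
Record is_completion (R : realType) (P : Type) (N : set P)
    (d : P -> P -> \bar R) (X : metricType R) (iota : P -> X) : Prop :=
  IsCompletion {
  completion_isometry : forall p q, N p -> N q ->
    (mdist (iota p) (iota q))%:E = d p q;
  completion_dense : closure (iota @` N) = [set: X];
  completion_complete : forall F : set_system X, ProperFilter F -> cauchy F ->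
    exists x : X, F --> x }.

Definition bilipschitz_equivalent (R : realType) (X : metricType R) (Q : Type)
    (Y : set Q) (d : Q -> Q -> \bar R) : Prop :=
  exists (f : X -> Q) (K : R),
    [/\ 0 < K, set_bij [set: X] Y f
      & forall x y : X,
          (d (f x) (f y) <= K%:E * (mdist x y)%:E)%E /\
          ((mdist x y)%:E <= K%:E * d (f x) (f y))%E].

(* Main.v *)
Require Import Defs.
From mathcomp Require Import all_boot all_order all_algebra.
From mathcomp Require Import all_classical all_reals all_analysis.
From mathcomp Require Import measurable_realfun.
From mathcomp Require Import lra ring.
Set Implicit Arguments.
Unset Strict Implicit.
Unset Printing Implicit Defensive.
Import Order.TTheory GRing.Theory Num.Theory.
Import numFieldNormedType.Exports.
Local Open Scope classical_set_scope.
Local Open Scope ring_scope.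

(** Let d be the distance of the slice metric at time t_0, and
    D((t, x), (s, y)) = |t - s| + d(x, y) on the closed slab, the product of the
    interval from 0 to tmax with M.  By compactness of the slab, all the slice
    metrics are locally comparable with the norm of a chart, with constants that do
    not depend on time ([riemannian_family_comparable]).  Everything follows from
    the fact that on the spacetime N the null distance and D are each at most a
    constant multiple of the other ([product_dist_equivalent]).

    D is at most a multiple of the null distance ([product_dist_le_null_dist])
    because a causal velocity (a, w) satisfies h(w, w) <= a^2.  Time is therefore
    strictly monotone along a causal segment, the displacement in M is at most a
    multiple of the variation of time, and the null length is the total variation of
    time.

    The null distance is at most a multiple of D ([cosmo_null_dist_le]) because a
    straight segment of a chart becomes causal once it is lifted with a sufficient
    time slope ([cosmo_chart_step]).  Going up along one such lift and down along
    another joins two points of one slice, and the null length is a multiple of their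
    distance in the chart ([cosmo_slice_near]).  A function that is subadditive and
    locally bounded by chart norms is bounded by a multiple of the Riemannian
    distance ([dist_le_riem_dist]), by subdividing curves.  The same lemma, applied
    to the variation of a truncated chart distance, shows that d separates points
    ([riem_dist_eq0]), and with it the null distance does too.

    Finally, M being compact, the closed slab is compact for the product topology and
    D is continuous on it.  Since N is dense in the slab and carries two equivalent
    distances, a completion of N for the null distance corresponds bijectively to the
    slab: a point x of the completion is matched with the cluster points of the part
    of N close to x, the comparison of the two distances passes to the limit, and
    compactness is transported ([completion_bilipschitz_equivalent],
    [completion_compact]). *)

(** * Chaining along a segment, and constants on a compact space *)

(** Let m be the supremum of the x such that [P a x] holds.  The local
    hypothesis at m first reaches m from some such x just below it, and then
    goes past m unless m is b.  All comparisons of a distance with a length, or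
    with the variation of the time function, are obtained by this chaining. *)
Lemma local_to_global_segment (R : realType) (a b : R) (P : R -> R -> Prop) :
  a <= b ->
  (forall u v w, a <= u -> u <= v -> v <= w -> w <= b ->
     P u v -> P v w -> P u w) ->
  (forall u, a <= u <= b -> exists2 e : R, 0 < e &
     forall v w, a <= v -> v <= w -> w <= b -> `|v - u| < e -> `|w - u| < e ->
       P v w) ->
  P a b.
Proof.
move=> ab trans loc.
pose S := [set x | a <= x <= b /\ P a x].
have Sa : S a.
  split; first by rewrite lexx ab.
  have [|e e0 He] := loc a; first by rewrite lexx ab.
  by apply: He; rewrite ?subrr ?normr0.
have ubS : ubound S b by move=> x [/andP[]].
have hsS : has_sup S by split; [exists a|exists b].
pose m := sup S.
have am : a <= m by apply: ub_le_sup => //; exact: hsS.2.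
have mb : m <= b by apply: ge_sup => //; exists a.
have [|e e0 He] := loc m; first by rewrite am mb.
have [x [/andP[ax xb] Pax] xm] : exists2 x, S x & m - e < x.
  by apply: sup_adherent.
have xlem : x <= m by apply: ub_le_sup => //; [exact: hsS.2|split; rewrite ?ax].
have [y [my yb ye ymax]] : exists y, [/\ m <= y, y <= b, `|y - m| < e &
    y = b \/ m < y].
  have [->|mnb] := eqVneq m b.
    by exists b; split; rewrite ?subrr ?normr0//; left.
  have mb' : m < b by rewrite lt_neqAle mnb.
  exists (Num.min b (m + e / 2)).
  have h0 : m < Num.min b (m + e / 2).
    by rewrite lt_min mb' ltrDl divr_gt0.
  split; [exact: ltW|by rewrite ge_min lexx| |by right].
  rewrite ger0_norm ?subr_ge0 ?ltW//.
  have : Num.min b (m + e / 2) <= m + e / 2 by rewrite ge_min lexx orbT.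
  lra.
have Pxy : P x y.
  apply: He => //; first exact: le_trans my.
  by rewrite ler0_norm; lra.
have Pay : P a y by apply: (trans a x y) => //; exact: le_trans my.
case: ymax => [<-//|my'].
have : S y by split; rewrite // yb (le_trans am my).
move/(ub_le_sup hsS.2); rewrite -/m => ym; lra.
Qed.

(** The translation pushes the Lebesgue measure forward to itself, because it
    does so on half-open intervals. *)
Lemma ge0_integral_itv_shift (R : realType) (c a b : R) (f : R -> \bar R) :
  measurable_fun `[a, b] f -> (forall x, 0 <= f x)%E ->
  (\int[lebesgue_measure]_(x in `[(a - c)%R, (b - c)%R]) f (x + c)%R
   = \int[lebesgue_measure]_(x in `[a, b]) f x)%E.
Proof.
move=> mf f0.
have mshift : measurable_fun [set: R] (fun x : R => x + c : R).
  by apply: measurable_funD.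
pose phi : measurableTypeR R -> measurableTypeR R := fun x : R => x + c : R.
have E A : measurable A -> pushforward lebesgue_measure phi A = @lebesgue_measure R A.
  move=> mA; apply/esym/lebesgue_measure_unique => //= _ [[x y]] _ <-.
  rewrite /pushforward.
  have -> : (phi @^-1` `]x, y] = `]x - c, y - c])%classic.
    apply/seteqP; split => z /=; rewrite !in_itv/= /phi; lra.
  rewrite !lebesgue_measure_itv/= !lte_fin ltrD2r.
  by case: ifP => // _; rewrite !EFinN -!EFinB; congr EFin; lra.
transitivity (\int[pushforward lebesgue_measure phi]_(x in `[a, b]) f x)%E; last first.
  by apply: eq_measure_integral => A mA _; exact: E.
rewrite ge0_integral_pushforward//.
congr (integral _ _ _); apply/seteqP; split => z /=; rewrite !in_itv/= /phi; lra.
Qed.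

(** The near-covering form of compactness, with the constant running along the
    filter of neighbourhoods of +oo, makes a locally valid constant uniform. *)
Lemma compact_uniform_constant (R : realType) (M : topologicalType)
    (P : R -> M -> Prop) : compact [set: M] ->
  (forall p : M, exists K0 : R, \forall q \near p, forall K, K0 < K -> P K q) ->
  exists2 K : R, 0 < K & forall p, P K p.
Proof.
move=> cM loc.
have : \forall K \near pinfty_nbhs R, [set: M] `<=` P K.
  move/compact_near_coveringP: cM; apply => p _; have [K0 nK0] := loc p.
  exists ([set q | forall K, K0 < K -> P K q], [set K | K0 < K]) => /=.
    by split=> //; exists K0; split => //; exact: num_real.
  by move=> [q K] [/= + K0K]; apply.
move=> [K0 [_ HK]]; exists (Num.max K0 0 + 1).
  by have := le_max 0 K0 0; rewrite lexx orbT; lra.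
by move=> p; apply: HK => //; have := le_max K0 K0 0; rewrite lexx /=; lra.
Qed.

Lemma near_open (T : topologicalType) (U : set T) x : open U -> U x ->
  \forall y \near x, U y.
Proof. by move=> oU Ux; exact: open_nbhs_nbhs (conj oU Ux). Qed.

Lemma continuous_at_eq (T T' : topologicalType) (U : set T) (f g : T -> T') x :
  open U -> U x -> (forall y, U y -> f y = g y) ->
  {for x, continuous f} -> {for x, continuous g}.
Proof.
move=> oU Ux fg cf; change (g @ x --> g x); rewrite -(fg _ Ux).
by apply: cvg_trans cf; apply: near_eq_cvg; apply: filterS (near_open oU Ux) => y; exact: fg.
Qed.

Lemma open_preimage_at (T T' : topologicalType) (J : set T) (U : set T') (c : T -> T') :
  open J -> open U -> (forall s, J s -> {for s, continuous c}) ->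
  open (J `&` c @^-1` U).
Proof.
move=> oJ oU cc; rewrite openE => s [Js Us].
apply: filterI; first exact: near_open.
exact: (cc s Js _ (near_open oU Us)).
Qed.

Lemma within_itv_near (R : realType) (a b : R) (T : topologicalType)
    (c : R -> T) (u : R) (U : set T) :
  {within `[a, b], continuous c} -> a <= u <= b -> nbhs (c u) U ->
  exists2 r : R, 0 < r & forall z, a <= z <= b -> `|z - u| < r -> U (c z).
Proof.
move=> /subspace_continuousP cc uab nU.
have : within `[a, b]%classic (nbhs u) (c @^-1` U).
  by apply: cc => //; rewrite /= in_itv.
move=> /nbhs_ballP[r /= r0 Hr]; exists r => // z zab zr.
by apply: Hr; [rewrite -ball_normE /= distrC|rewrite /= in_itv].
Qed.

(** * Differential calculus of the C^k predicate *)

Section calculus.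
Context (R : realType).
Implicit Types V W : normedModType R.

(** On an open set a function may be replaced by one that agrees with it there;
    this is what makes the recursion on directional derivatives usable, since
    the derivatives are known by a formula on the open set only. *)
Lemma Ck_eq W k (U : set R) (f g : R -> W) : open U ->
  (forall x, U x -> f x = g x) -> Ck k U f -> Ck k U g.
Proof.
move=> oU; elim: k f g => [|k IH] f g fg /=.
  move=> Cf x Ux; have fx := Cf x Ux.
  have nfg : \forall y \near x, f y = g y.
    by apply: filterS (open_nbhs_nbhs (conj oU Ux)) => y; exact: fg.
  change (g @ x --> g x); rewrite -(fg _ Ux).
  by apply: cvg_trans fx; apply: near_eq_cvg.
move=> [Df Cf].
have nfg x : U x -> \forall y \near x, f y = g y.
  by move=> Ux; apply: filterS (open_nbhs_nbhs (conj oU Ux)) => y; exact: fg.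
split.
  move=> x Ux; apply/derivable1_diffP.
  apply: near_eq_derivable (nfg x Ux) _; exact/derivable1_diffP/Df.
by move=> v; apply: IH (Cf v) => x Ux; exact: near_eq_derive (nfg x Ux).
Qed.

Lemma Ck_cst V W k (U : set V) (a : W) : Ck k U (cst a).
Proof.
elim: k a => [|k IH] a /=; first by move=> x _; exact: cvg_cst.
split=> [x _|v]; first exact: differentiable_cst.
have -> : 'D_v (cst a) = cst 0 :> (V -> W) by apply/funext => x; exact: derive_cst.
exact: IH.
Qed.

Lemma Ck_id V k (U : set V) : Ck k U (id : V -> V).
Proof.
case: k => [|k] /=; first by move=> x _; exact: cvg_id.
split=> [x _|v]; first exact: ex_diff.
have -> : 'D_v id = cst v :> (V -> V) by apply/funext => x; exact: derive_id.
exact: Ck_cst.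
Qed.

Lemma is_diff_affine V (y w : V) (u : R) :
  is_diff u (fun u : R => y + u *: w) (fun v : R => v *: w).
Proof.
have := @is_diffD _ _ _ (cst y) (fun u : R => u *: w) 0 (fun v : R => v *: w) u _ _.
by rewrite add0r; apply.
Qed.

Lemma differentiable_affine V (y w : V) (u : R) :
  differentiable (fun u : R => y + u *: w) u.
Proof. by have := is_diff_affine y w u => ?; exact: ex_diff. Qed.

Lemma continuous_affine V (y w : V) : continuous (fun u : R => y + u *: w).
Proof.
by move=> u; exact/differentiable_continuous/differentiable_affine.
Qed.

Lemma is_derive_affine V (y w : V) (u v : R) :
  is_derive u v (fun u : R => y + u *: w) (v *: w).
Proof.
have h := is_diff_affine y w u.
have D := differentiable_affine y w u.
apply: DeriveDef; first exact: diff_derivable.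
by rewrite deriveE// diff_val.
Qed.

Lemma open_affine_preimage V (U : set V) (y w : V) : open U ->
  open ((fun u : R => y + u *: w) @^-1` U).
Proof. by move=> oU; apply: open_comp => // u _; exact: continuous_affine. Qed.

(** Precomposition with an affine parametrization of a line serves three
    purposes: it shows that straight segments in a chart are smooth curves, and it
    translates and reverses the parameter of a curve. *)
Lemma Ck_affine V W k (U : set V) (f : V -> W) (y w : V) : open U ->
  Ck k U f -> Ck k ((fun u : R => y + u *: w) @^-1` U) (fun u => f (y + u *: w)).
Proof.
move=> oU; elim: k f => [|k IH] f /=.
  move=> Cf u Uu; apply: (@continuous_comp _ _ _ (fun u : R => y + u *: w) f).
    exact: continuous_affine.
  exact: Cf.
move=> [Df Cf].
have D u : U (y + u *: w) -> differentiable (fun u : R => f (y + u *: w)) u.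
  move=> Uu; apply: (@differentiable_comp _ _ _ _ (fun u : R => y + u *: w) f).
    exact: differentiable_affine.
  exact: Df.
split=> // v; apply: Ck_eq (IH _ (Cf (v *: w))); first exact: open_affine_preimage.
move=> u /= Uu; rewrite deriveE; last exact: Df.
rewrite deriveE; last exact: D.
rewrite (@diff_comp _ _ _ _ (fun u : R => y + u *: w) f); last exact: Df.
  by have h := is_diff_affine y w u; rewrite /= diff_val.
exact: differentiable_affine.
Qed.

Lemma derive_pair V W (f : R -> V) (g : R -> W) (u v : R) :
  derivable f u 1 -> derivable g u 1 ->
  'D_v (fun u => (f u, g u)) u = ('D_v f u, 'D_v g u).
Proof.
move=> /derivable1_diffP df /derivable1_diffP dg.
rewrite deriveE; last exact: differentiable_pair.
by rewrite diff_pair//= deriveE// deriveE.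
Qed.

Lemma Ck_pair V W k (U : set R) (f : R -> V) (g : R -> W) : open U ->
  Ck k U f -> Ck k U g -> Ck k U (fun u => (f u, g u)).
Proof.
move=> oU; elim: k f g => [|k IH] f g /=.
  by move=> Cf Cg u Uu; apply: cvg_pair; [exact: Cf|exact: Cg].
move=> [Df Cf] [Dg Cg]; split.
  by move=> u Uu; apply: differentiable_pair; [exact: Df|exact: Dg].
move=> v; apply: Ck_eq (IH _ _ (Cf v) (Cg v)) => // u Uu.
by rewrite derive_pair//; apply/derivable1_diffP; [exact: Df|exact: Dg].
Qed.

Lemma smooth_onW V W (U U' : set V) (f : V -> W) :
  U' `<=` U -> smooth_on U f -> smooth_on U' f.
Proof.
move=> UU' sf k; have := sf k; elim: k f {sf} => [|k IH] f /=.
  by move=> Cf x /UU'; exact: Cf.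
by move=> [Df Cf]; split=> [x /UU'|v]; [exact: Df|exact: IH].
Qed.

End calculus.

(** * Smooth curves in an atlas and their velocities *)

Section curves.
Context (R : realType) (E : normedModType R) (P : topologicalType) (A : atlas E P).

Hypothesis open_dom : forall i, open (dom A i).

Lemma smooth_curve_eq (J : set R) (c c' : R -> P) : open J ->
  (forall s, J s -> c s = c' s) -> smooth_curve A J c -> smooth_curve A J c'.
Proof.
move=> oJ cc' [cd cc cs]; split.
- by move=> s Js; rewrite -cc'//; exact: cd.
- by move=> s Js; apply: (continuous_at_eq oJ Js cc'); exact: cc.
- move=> i k.
  have -> : J `&` c' @^-1` dom A i = J `&` c @^-1` dom A i.
    by apply/seteqP; split => s [Js /=]; rewrite cc'.
  apply: Ck_eq (cs i k); first exact: open_preimage_at.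
  by move=> s [Js _] /=; rewrite cc'.
Qed.

Lemma smooth_curveW (J J' : set R) (c : R -> P) :
  J' `<=` J -> smooth_curve A J c -> smooth_curve A J' c.
Proof.
move=> JJ' [cd cc cs]; split=> [s /JJ'|s /JJ'|i]; [exact: cd|exact: cc|].
by apply: smooth_onW (cs i) => s [/JJ' Js ?].
Qed.

Lemma smooth_curve_affine (J : set R) (c : R -> P) (y w : R) : open J ->
  smooth_curve A J c ->
  smooth_curve A ((fun u => y + u *: w) @^-1` J) (fun u => c (y + u *: w)).
Proof.
move=> oJ [cd cc cs]; split.
- by move=> s /cd.
- move=> s Js; apply: (@continuous_comp _ _ _ (fun u : R => y + u *: w) c).
    exact: (@continuous_affine R (R : normedModType R)).
  exact: cc.
- move=> i k.
  have oU := open_preimage_at oJ (open_dom i) cc.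
  exact: Ck_affine (cs i k).
Qed.

Lemma smooth_curve_derivable (J : set R) (c : R -> P) i s :
  smooth_curve A J c -> J s -> dom A i (c s) -> derivable (chart A i \o c) s 1.
Proof.
move=> [_ _ cs] Js ds; apply/derivable1_diffP.
by have [D _] := cs i 1%N; apply: D.
Qed.

Lemma smooth_curve_velocity_continuous (J : set R) (c : R -> P) i s :
  smooth_curve A J c -> J s -> dom A i (c s) -> {for s, continuous (velocity (A:=A) i c)}.
Proof.
move=> [_ _ cs] Js ds.
by have [_ D] := cs i 1%N; have := D 1 s; apply.
Qed.

Lemma smooth_curve_continuous (J : set R) (c : R -> P) s :
  smooth_curve A J c -> J s -> {for s, continuous c}.
Proof. by move=> [_ cc _]; exact: cc. Qed.

Lemma velocity_eq i (c c' : R -> P) s :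
  (\forall u \near s, c u = c' u) -> velocity (A:=A) i c s = velocity (A:=A) i c' s.
Proof.
move=> cc'; apply: near_eq_derive; apply: filterS cc' => u /=.
by move=> ->.
Qed.

Lemma velocity_affine (J : set R) i (c : R -> P) (y w s : R) :
  smooth_curve A J c -> J (y + s *: w) -> dom A i (c (y + s *: w)) ->
  velocity (A:=A) i (fun u => c (y + u *: w)) s =
  w *: velocity (A:=A) i c (y + s *: w).
Proof.
move=> cs Js ds; rewrite /velocity.
have /derivable1_diffP D := smooth_curve_derivable cs Js ds.
have Da := @differentiable_affine R (R : normedModType R) y w s.
have h := @is_diff_affine R (R : normedModType R) y w s.
rewrite deriveE; last exact: (@differentiable_comp _ _ _ _ (fun u : R => y + u *: w) (chart A i \o c)).
rewrite (@diff_comp _ _ _ _ (fun u : R => y + u *: w) (chart A i \o c))//=.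
rewrite diff_val deriveE//.
have -> : 1 *: w = w *: (1 : R) by rewrite /GRing.scale/= mulrC.
by rewrite linearZ.
Qed.

Hypothesis chartK : forall i p, dom A i p -> param A i (chart A i p) = p.

(** Chain rule: near [s] the curve read in [j] is the transition map applied
    to the curve read in [i]. *)
Lemma velocity_transition (J : set R) i j (c : R -> P) s : open J ->
  smooth_curve A J c -> J s -> dom A i (c s) -> dom A j (c s) ->
  differentiable (chart A j \o param A i) (chart A i (c s)) ->
  velocity (A:=A) j c s =
  'd (chart A j \o param A i) (chart A i (c s)) (velocity (A:=A) i c s).
Proof.
move=> oJ cs Js di dj D; rewrite /velocity.
have /derivable1_diffP Di := smooth_curve_derivable cs Js di.
transitivity ('D_1 ((chart A j \o param A i) \o (chart A i \o c)) s).
  apply: near_eq_derive.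
  have ns : \forall u \near s, dom A i (c u).
    exact: (smooth_curve_continuous cs Js (near_open (open_dom i) di)).
  by apply: filterS ns => u /= du; rewrite chartK.
rewrite [LHS]deriveE; last exact: (@differentiable_comp _ _ _ _ (chart A i \o c)).
rewrite (@diff_comp _ _ _ _ (chart A i \o c) (chart A j \o param A i))//=.
by rewrite deriveE.
Qed.

End curves.

(** * Symmetric forms and Lorentz signature *)

Section symmetric_forms.
Context (R : realType) (E : lmodType R) (g : E -> E -> R).
Hypothesis glin : forall (a : R) u v w, g (a *: u + v) w = a * g u w + g v w.
Hypothesis gsym : forall v w, g v w = g w v.

Lemma form0l w : g 0 w = 0.
Proof. by have := glin (-1) 0 0 w; rewrite scaler0 addr0; lra. Qed.

Lemma formZl a v w : g (a *: v) w = a * g v w.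
Proof. by rewrite -[a *: v]addr0 glin form0l addr0. Qed.

Lemma formDl u v w : g (u + v) w = g u w + g v w.
Proof. by have := glin 1 u v w; rewrite scale1r mul1r. Qed.

Lemma formZr a v w : g v (a *: w) = a * g v w.
Proof. by rewrite gsym formZl gsym. Qed.

Lemma form_suml n (a : 'I_n -> R) (e : 'I_n -> E) w :
  g (\sum_i a i *: e i) w = \sum_i a i * g (e i) w.
Proof.
apply: (big_ind2 (fun v r => g v w = r)); first exact: form0l.
- by move=> v r v' r' <- <-; exact: formDl.
- by move=> i _; exact: formZl.
Qed.

Lemma form_sum n m (a : 'I_n -> R) (e : 'I_n -> E) (b : 'I_m -> R) (f : 'I_m -> E) :
  g (\sum_i a i *: e i) (\sum_j b j *: f j)
  = \sum_i \sum_j a i * b j * g (e i) (f j).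
Proof.
rewrite form_suml; apply: eq_bigr => i _.
rewrite gsym form_suml big_distrr /=; apply: eq_bigr => j _.
by rewrite (gsym (f j)) mulrA.
Qed.

End symmetric_forms.

(** With B, C the sums of the squares of the [b i] and of the products
    [a i * b i], the nonnegative sum of the squares of [a i * B - b i * C] equals
    B times the difference of the two sides. *)
Lemma cauchy_schwarz_sum (R : realType) n (a b : 'I_n -> R) :
  0 < \sum_i b i ^+ 2 ->
  (\sum_i a i * b i) ^+ 2 <= (\sum_i a i ^+ 2) * (\sum_i b i ^+ 2).
Proof.
set A := \sum_i a i ^+ 2; set B := \sum_i b i ^+ 2; set C := \sum_i a i * b i.
move=> B0.
have : 0 <= \sum_i (a i * B - b i * C) ^+ 2.
  by apply: sumr_ge0 => i _; exact: sqr_ge0.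
have -> : \sum_i (a i * B - b i * C) ^+ 2 = B * (A * B - C ^+ 2).
  transitivity (B ^+ 2 * A - B * C * C *+ 2 + C ^+ 2 * B); last by ring.
  rewrite [X in _ - X *+ 2](_ : _ = \sum_i B * C * (a i * b i)); last by rewrite big_distrr.
  have -> : B ^+ 2 * A = \sum_i B ^+ 2 * a i ^+ 2 by rewrite big_distrr.
  have -> : C ^+ 2 * B = \sum_i C ^+ 2 * b i ^+ 2 by rewrite big_distrr.
  rewrite -sumrMnl -sumrB -big_split/=.
  by apply: eq_bigr => i _; ring.
by rewrite pmulr_rge0// subr_ge0.
Qed.

(** Reversed Cauchy-Schwarz inequality: the orthogonal of a timelike vector is
    positive definite.  In a pseudo-orthonormal basis write a, b for the
    coordinates of t, w, and A, B, C for the spatial parts of the sums of the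
    a_i^2, b_i^2 and a_i b_i.  Then A < a_0^2 and C = a_0 b_0, so
    a_0^2 b_0^2 = C^2 <= A B < a_0^2 B as soon as B is positive. *)
Lemma lorentz_orthogonal_gt0 (R : realType) (E : normedModType R) n (g : E -> E -> R)
    (glin : forall (a : R) u v w, g (a *: u + v) w = a * g u w + g v w)
    (gsym : forall v w, g v w = g w v) (t w : E) :
  lorentz_signature n g -> g t t < 0 -> g t w = 0 -> w != 0 -> 0 < g w w.
Proof.
move=> [e [span gram]].
have expand (a b : 'I_n.+1 -> R) : g (\sum_i a i *: e i) (\sum_j b j *: e j)
    = - (a ord0 * b ord0) + \sum_(i < n) a (lift ord0 i) * b (lift ord0 i).
  rewrite form_sum//.
  rewrite (eq_bigr (fun i => a i * b i * (if i == ord0 then -1 else 1))); last first.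
    move=> i _; rewrite (bigD1 i)//= big1 ?addr0; last first.
      by move=> j ji; rewrite gram eq_sym (negbTE ji) mulr0.
    by rewrite gram eqxx.
  rewrite big_ord_recl /= mulrN1; congr (_ + _).
  by apply: eq_bigr => i _; rewrite mulr1.
have [a ->] := span t; have [b ->] := span w.
rewrite !expand.
set A := \sum_(i < n) a _ * a _; set B := \sum_(i < n) b _ * b _.
set C := \sum_(i < n) a _ * b _.
have A0 : 0 <= A by apply: sumr_ge0 => i _; rewrite -expr2 sqr_ge0.
have B0 : 0 <= B by apply: sumr_ge0 => i _; rewrite -expr2 sqr_ge0.
move=> At Ct w0.
have [B_eq0|B_neq0] := eqVneq B 0.
  have bi i : b (lift ord0 i) = 0.
    have /psumr_eq0P : B = 0 by [].
    by move=> /(_ (fun i _ => sqr_ge0 _) i isT)/eqP; rewrite mulf_eq0 orbb => /eqP.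
  have C_eq0 : C = 0 by rewrite /C big1// => i _; rewrite bi mulr0.
  have /eqP : a ord0 * b ord0 = 0 by lra.
  rewrite mulf_eq0 => /orP[/eqP a0|/eqP b0]; first by rewrite a0 mul0r in At; lra.
  by move/eqP: w0; case; rewrite big_ord_recl b0 scale0r add0r big1// => i _;
    rewrite bi scale0r.
have B_gt0 : 0 < B by rewrite lt_neqAle eq_sym B_neq0.
have CS : C ^+ 2 <= A * B.
  rewrite /A /B; under eq_bigr do rewrite -expr2.
  under [X in _ <= _ * X]eq_bigr do rewrite -expr2.
  apply: cauchy_schwarz_sum.
  by under eq_bigr do rewrite expr2.
have Cab : C = a ord0 * b ord0 by lra.
have a0 : 0 < a ord0 ^+ 2 by rewrite expr2; lra.
have : a ord0 ^+ 2 * b ord0 ^+ 2 < a ord0 ^+ 2 * B.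
  rewrite -exprMn -Cab; apply: le_lt_trans CS _.
  by rewrite ltr_pM2r// expr2; lra.
rewrite ltr_pM2l// expr2; lra.
Qed.

(** * The slices of a cosmological spacetime are Riemannian *)

Section product_transition.
Context (R : realType) (E : normedModType R).

Lemma is_diff_fst (V W : normedModType R) (y : V * W) : is_diff y fst fst.
Proof.
have cf : continuous (fst : V * W -> V) by move=> x; exact: cvg_fst.
apply: DiffDef; first exact: (@linear_differentiable _ _ _ fst).
exact: (@diff_lin _ _ _ fst).
Qed.

Lemma is_diff_snd (V W : normedModType R) (y : V * W) : is_diff y snd snd.
Proof.
have cf : continuous (snd : V * W -> W) by move=> x; exact: cvg_snd.
apply: DiffDef; first exact: (@linear_differentiable _ _ _ snd).
exact: (@diff_lin _ _ _ snd).
Qed.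

Lemma differentiable_fst (V W : normedModType R) (y : V * W) : differentiable fst y.
Proof. by have := is_diff_fst y => ?; exact: ex_diff. Qed.

Lemma differentiable_snd (V W : normedModType R) (y : V * W) : differentiable snd y.
Proof. by have := is_diff_snd y => ?; exact: ex_diff. Qed.

Lemma differentiable_prod_id (phi : E -> E) (y : R * E) :
  differentiable phi y.2 -> differentiable (fun y : R * E => (y.1, phi y.2)) y.
Proof.
move=> D; apply: differentiable_pair; first exact: differentiable_fst.
apply: (@differentiable_comp _ _ _ _ snd phi) => //; exact: differentiable_snd.
Qed.

Lemma diff_prod_id (phi : E -> E) (y v : R * E) :
  differentiable phi y.2 ->
  'd (fun y : R * E => (y.1, phi y.2)) y v = (v.1, 'd phi (y.2) v.2).
Proof.
move=> D; have Ds := differentiable_snd y; have Df := differentiable_fst y.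
rewrite (@diff_pair _ _ _ _ fst (phi \o snd))//; last exact: differentiable_comp.
rewrite (@diff_comp _ _ _ _ snd phi)//=.
have h := is_diff_fst y; have h' := is_diff_snd y.
by rewrite (@diff_val _ _ _ _ _ _ _ h) (@diff_val _ _ _ _ _ _ _ h').
Qed.

End product_transition.

Section manifold.
Context (R : realType) (n : nat) (M : topologicalType) (A : atlas 'rV[R]_n M).
Hypothesis MA : smooth_manifold A.

Lemma transition_differentiable i j p : dom A i p -> dom A j p ->
  differentiable (chart A j \o param A i) (chart A i p).
Proof.
move=> di dj; have [D _] := manifold_transition MA i j 1%N.
by apply: D; exists p.
Qed.

Lemma product_atlas_open_dom (I : set R) : open I ->
  forall i, open (dom (product_atlas I A) i).
Proof. move=> oI i; apply: (@openI _ (fst @^-1` I) (snd @^-1` dom A i)).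
  by apply: open_comp => // p _; exact: cvg_fst.
by apply: open_comp => [p _|]; [exact: cvg_snd|exact: manifold_open_dom]. Qed.

Lemma product_atlas_chartK (I : set R) i p : dom (product_atlas I A) i p ->
  param (product_atlas I A) i (chart (product_atlas I A) i p) = p.
Proof.
case: p => t x [/= _ di]; rewrite /= (manifold_chartK MA)//.
Qed.

Lemma product_transition_differentiable (I : set R) i j (p : R * M) :
  dom A i p.2 -> dom A j p.2 ->
  differentiable (chart (product_atlas I A) j \o param (product_atlas I A) i)
    (chart (product_atlas I A) i p).
Proof.
move=> di dj.
apply: (@differentiable_prod_id _ _ (chart A j \o param A i)).
exact: transition_differentiable.
Qed.

Lemma diff_product_transition (I : set R) i j (p : R * M) v :
  dom A i p.2 -> dom A j p.2 ->
  'd (chart (product_atlas I A) j \o param (product_atlas I A) i)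
    (chart (product_atlas I A) i p) v =
  (v.1, 'd (chart A j \o param A i) (chart A i p.2) v.2).
Proof.
move=> di dj.
by rewrite (@diff_prod_id _ _ (chart A j \o param A i)) //; exact: transition_differentiable.
Qed.

End manifold.

Section slices.
Context (R : realType) (n : nat) (M : topologicalType) (A : atlas 'rV[R]_n M)
  (tmax : R) (h : tensor2 (cosmo_atlas A tmax)) (hbar : R -> tensor2 A).
Hypothesis Hc : cosmological_spacetime h.
Hypothesis Hx : extends_continuously h hbar.

Let MA := cosmo_manifold Hc.

Lemma cosmo_radical_dt i p : dom (cosmo_atlas A tmax) i p ->
  forall w, h i p (1, 0) w = 0.
Proof. by move=> dp; apply/(cosmo_radical Hc dp); exists 1; rewrite scale1r. Qed.

(** Since d/dt is in the radical, [h] only sees the components along the slice. *)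
Lemma cosmo_slice_form i (t : R) x (a b : R) (v w : 'rV[R]_n) : 0 < t < tmax -> dom A i x ->
  h i (t, x) (a, v) (b, w) = hbar t i x v w.
Proof.
move=> t0 dx.
have dp : dom (cosmo_atlas A tmax) i (t, x) by split; rewrite //= in_itv.
rewrite (ext_agree Hx t0 dx).
have lin := tensor2_linear (cosmo_tensor Hc) dp.
have sym := tensor2_sym (cosmo_tensor Hc) dp.
have E (c : R) (u : 'rV[R]_n) z : h i (t, x) (c, u) z = h i (t, x) (0, u) z.
  have -> : (c, u) = c *: (1, 0) + (0, u) :> R * 'rV[R]_n.
    by congr (_, _); rewrite /= ?scaler0 ?add0r// addr0 /GRing.scale/= mulr1.
  by rewrite lin cosmo_radical_dt// mulr0 add0r.
by rewrite E sym E sym.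
Qed.

Lemma slice_within_continuous i (t : R) (v w : 'rV[R]_n) p : 0 <= t <= tmax -> dom A i p ->
  {for p, continuous (fun q => hbar t i q v w)}.
Proof.
move=> t0 dp.
have /subspace_continuousP/(_ (t, p)) := @ext_continuous _ _ _ _ _ _ _ Hx i v w.
have tp : (`[0, tmax] `*` dom A i) (t, p) by split; rewrite //= in_itv.
move=> /(_ tp) C.
apply: (@cvg_comp _ _ _ (fun q => (t, q)) (fun p : R * M => hbar p.1 i p.2 v w)); last exact: C.
move=> U /=; rewrite /nbhs/= /within/= => nU.
have : \forall q \near p, (`[0, tmax] `*` dom A i) (t, q) -> U (t, q).
  have c2 : (fun q : M => (t, q)) @ p --> (t, p).
    apply: (@cvg_pair _ _ _ (nbhs p) (nbhs t) (nbhs p) _ _ _ (fun=> t) id).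
      exact: cvg_cst.
    exact: cvg_id.
  exact: (c2 _ nU).
apply: filter_app; apply: filterS (near_open (manifold_open_dom MA i) dp) => q dq.
by apply; split; rewrite //= in_itv.
Qed.

(** At the two ends this is assumed.  For interior times, the slice is orthogonal
    to the timelike vector d/dt, hence positive definite because the spacetime
    metric has Lorentz signature; compatibility with the transition maps is
    inherited from [h] along the vectors tangent to the slice. *)
Lemma slice_riemannian (t : R) : 0 <= t <= tmax -> continuous_riemannian_metric (hbar t).
Proof.
move=> t01.
have [->|t0] := eqVneq t 0; first exact: ext_riem0 Hx.
have [->|tT] := eqVneq t tmax; first exact: ext_riem_tmax Hx.
have t0T : 0 < t < tmax.
  by move/andP: t01 => [a b]; rewrite !lt_neqAle a b eq_sym t0 tT.
have dp i x : dom A i x -> dom (cosmo_atlas A tmax) i (t, x).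
  by move=> dx; split; rewrite //= in_itv.
split.
- split.
  + move=> i x dx a u v w.
    rewrite !(ext_agree Hx t0T dx) -(tensor2_linear (cosmo_tensor Hc) (dp _ _ dx)).
    by congr (h _ _ (_, _) _); rewrite /= scaler0 addr0.
  + move=> i x dx v w; rewrite !(ext_agree Hx t0T dx).
    exact: (tensor2_sym (cosmo_tensor Hc) (dp _ _ dx)).
  + move=> i j x di dj v w; rewrite (ext_agree Hx t0T di).
    rewrite (tensor2_transition (cosmo_tensor Hc) (dp _ _ di) (dp _ _ dj)).
    by rewrite !(diff_product_transition MA)//= cosmo_slice_form.
- by move=> i v w p dx; exact: slice_within_continuous.
- move=> i x dx v v0; rewrite (ext_agree Hx t0T dx).
  have gw a b : cosmo_metric h i (t, x) (a, v) (b, v) = - (a * b) + h i (t, x) (0, v) (0, v).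
    by rewrite /cosmo_metric/= (cosmo_slice_form _ _ _ _ t0T dx) (ext_agree Hx t0T dx).
  suff : 0 < cosmo_metric h i (t, x) (0, v) (0, v) by rewrite gw mul0r oppr0 add0r.
  apply: (@lorentz_orthogonal_gt0 R (R * 'rV[R]_n)%type n (cosmo_metric h i (t, x))
    _ _ (1, 0) (0, v) (cosmo_lorentzian Hc (dp _ _ dx))).
  + move=> a u1 u2 w; rewrite /cosmo_metric (tensor2_linear (cosmo_tensor Hc) (dp _ _ dx)) /=.
    by rewrite /GRing.scale/=; ring.
  + by move=> u w; rewrite /cosmo_metric (tensor2_sym (cosmo_tensor Hc) (dp _ _ dx)) mulrC.
  + by rewrite /cosmo_metric/= cosmo_radical_dt ?mul1r ?addr0 ?ltrN10//; exact: dp.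
  + by rewrite /cosmo_metric/= cosmo_radical_dt ?mulr0 ?addr0 ?oppr0//; exact: dp.
  + by apply: contra_neq v0 => -[].
Qed.

End slices.

(** * Comparison of a family of metrics with the norm of a chart *)

Section comparison.
Context (R : realType) (n : nat) (M : topologicalType) (A : atlas 'rV[R]_n M).

Lemma tensor_coord (T : tensor2 A) i p (v w : 'rV[R]_n) :
  symmetric_tensor2 T -> dom A i p ->
  T i p v w = \sum_(j < n) \sum_(k < n) v 0 j * w 0 k * T i p 'e_j 'e_k.
Proof.
move=> ST dp.
by rewrite {1}[v]row_sum_delta {1}[w]row_sum_delta
  (form_sum (tensor2_linear ST dp) (tensor2_sym ST dp)).
Qed.

Lemma sphere_compact : compact [set v : 'rV[R]_n | `|v| = 1].
Proof.
apply: bounded_closed_compact.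
  exists 1; split; first exact: num_real.
  by move=> x x1 v /= ->; exact: ltW.
have -> : [set v : 'rV[R]_n | `|v| = 1] = (Num.norm : 'rV[R]_n -> R) @^-1` [set 1] by [].
by apply: closed_comp => [v _|]; [exact: norm_continuous|exact: closed_eq].
Qed.

(** The tensors are only known to be continuous entry by entry; expanding in
    the canonical basis gives joint continuity in the parameter, the point and the
    vectors. *)
Lemma tensor_family_cvg (hb : R -> tensor2 A) (B : set R) (I : Type) (F : set_system I)
    (FF : Filter F) (t : I -> R) (q : I -> M) (v w : I -> 'rV[R]_n) i t0 p v0 w0 :
  (forall s, B s -> symmetric_tensor2 (hb s)) ->
  (forall v w, {within B `*` dom A i, continuous (fun p : R * M => hb p.1 i p.2 v w)}) ->
  B t0 -> dom A i p -> (\forall z \near F, B (t z) /\ dom A i (q z)) ->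
  t @ F --> t0 -> q @ F --> p -> v @ F --> v0 -> w @ F --> w0 ->
  hb (t z) i (q z) (v z) (w z) @[z --> F] --> hb t0 i p v0 w0.
Proof.
move=> ST cont Bt dp nB ct cq cv cw.
rewrite (tensor_coord _ _ (ST _ Bt) dp).
apply: cvg_trans (_ : (\sum_(j < n) \sum_(k < n) v z 0 j * w z 0 k *
    hb (t z) i (q z) 'e_j 'e_k) @[z --> F] --> _); first last.
  apply: cvg_big => [|j _]; first exact: add_continuous.
  apply: cvg_big => [|k _]; first exact: add_continuous.
  have coord (u : I -> 'rV[R]_n) (u0 : 'rV[R]_n) l : u @ F --> u0 -> u z 0 l @[z --> F] --> u0 0 l.
    move=> cu; apply: (@cvg_comp _ _ _ u (fun M : 'rV[R]_n => M 0 l) _ (nbhs u0)) => //.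
    exact: coord_continuous.
  apply: cvgM; first by apply: cvgM; exact: coord.
  have /subspace_continuousP/(_ (t0, p)) := cont 'e_j 'e_k.
  move=> /(_ (conj Bt dp)) C.
  apply: (@cvg_comp _ _ _ (fun z => (t z, q z))
    (fun p : R * M => hb p.1 i p.2 'e_j 'e_k)); last exact: C.
  move=> U /= nU.
  have c2 : (fun z => (t z, q z)) @ F --> (t0, p).
    exact: (@cvg_pair _ _ _ F (nbhs t0) (nbhs p) _ _ _ t q ct cq).
  have : \forall z \near F, (B `*` dom A i) (t z, q z) -> U (t z, q z) by exact: (c2 _ nU).
  by apply: filter_app; apply: filterS nB => z Bz; apply.
apply: near_eq_cvg; apply: filterS nB => z [Bz dz].
by rewrite (tensor_coord _ _ (ST _ Bz) dz).
Qed.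

(** The quadratic form is positive and continuous on the product of the compact
    set of parameters with the unit sphere of the model space, so at each of its
    points it lies between 1/K and K, for K large and q close to p; compactness
    makes K and the neighbourhood of p uniform, and homogeneity does the rest. *)
Lemma riemannian_family_comparable (hb : R -> tensor2 A) (B : set R) i p :
  smooth_manifold A -> compact B ->
  (forall s, B s -> continuous_riemannian_metric (hb s)) ->
  (forall v w, {within B `*` dom A i, continuous (fun p : R * M => hb p.1 i p.2 v w)}) ->
  dom A i p ->
  exists2 K : R, 0 < K & \forall q \near p, forall t, B t -> forall v : 'rV[R]_n,
    `|v| <= K * Num.sqrt (hb t i q v v) /\ Num.sqrt (hb t i q v v) <= K * `|v|.
Proof.
move=> MA cB RM cont dp.
have ST s : B s -> symmetric_tensor2 (hb s) by move=> /RM; exact: riem_tensor.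
pose C := B `*` [set v : 'rV[R]_n | `|v| = 1].
have cC : compact C by apply: compact_setX => //; exact: sphere_compact.
pose P (qK : M * R) (tv : R * 'rV[R]_n) := dom A i qK.1 -> B tv.1 ->
  1 <= qK.2 * hb tv.1 i qK.1 tv.2 tv.2 /\ hb tv.1 i qK.1 tv.2 tv.2 <= qK.2.
have : \forall qK \near filter_prod (nbhs p) (pinfty_nbhs R), C `<=` P qK.
  move/compact_near_coveringP: cC; apply => -[t v] [/= Bt v1].
  have v0 : v != 0 by rewrite -normr_eq0 v1 oner_eq0.
  pose a := hb t i p v v.
  have a0 : 0 < a by apply: riem_posdef => //; exact: RM.
  pose D := [set z : (R * 'rV[R]_n) * M | B z.1.1 /\ dom A i z.2].
  (* Continuity holds only within the parameter set and the chart domain. *)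
  have G : hb z.1.1 i z.2 z.1.2 z.1.2 @[z --> within D (nbhs ((t, v), p))] --> a.
    have c1 : z.1 @[z --> nbhs ((t, v), p)] --> (t, v) by exact: cvg_fst.
    apply: tensor_family_cvg => //.
    - exact: ST.
    - exact: withinT.
    - apply: cvg_within_filter; apply: cvg_comp c1 _; exact: cvg_fst.
    - apply: cvg_within_filter; exact: cvg_snd.
    - apply: cvg_within_filter; apply: cvg_comp c1 _; exact: cvg_snd.
    - apply: cvg_within_filter; apply: cvg_comp c1 _; exact: cvg_snd.
  have : \forall z \near within D (nbhs ((t, v), p)), `|a - hb z.1.1 i z.2 z.1.2 z.1.2| < a / 2.
    by move/cvgrPdist_lt: G; apply; rewrite divr_gt0.
  move=> [[U V] /= [nU nV] UV].
  exists (U, V `*` [set K | 2 / a + 2 * a < K]) => /=.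
    split=> //=; exists (V, [set K | 2 / a + 2 * a < K]) => //=; split=> //.
    exists (2 / a + 2 * a); split => //; exact: num_real.
  move=> [[t' v'] [q K]] [/= Uz [Vq aK]] dq Bt'.
  have /= := UV ((t', v'), q) (conj Uz Vq) (conj Bt' dq).
  set b := hb t' i q v' v'; move=> ab.
  have := ler_norm (a - b); have := ler_norm (b - a); rewrite (distrC b) => ab1 ab2.
  have b2 : a / 2 <= b by lra.
  have ia0 : 0 < 2 / a by rewrite divr_gt0.
  split; last lra.
  have : 2 / a * (a / 2) <= K * b.
    apply: ler_pM => //; [lra|lra|lra].
  by have -> : 2 / a * (a / 2) = 1 by field; rewrite gt_eqF.
move=> [[V W] /= [nV [K0 [_ K0W]]] VW].
pose K := Num.max K0 0 + 1.
have WK : W K by apply: K0W; rewrite /K; have := le_max K0 K0 0; rewrite lexx /=; lra.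
have K_gt0 : 0 < K by rewrite /K; have := le_max 0 K0 0; rewrite lexx orbT; lra.
exists (Num.sqrt K); first by rewrite sqrtr_gt0.
have := near_open (manifold_open_dom MA i) dp.
apply: filter_app; apply: filterS nV => q Vq dq t Bt v.
have bnd : `|v| ^+ 2 <= K * hb t i q v v /\ hb t i q v v <= K * `|v| ^+ 2.
  have lin := tensor2_linear (ST t Bt) dq; have sym := tensor2_sym (ST t Bt) dq.
  have [->|v0] := eqVneq v 0.
    by rewrite (form0l lin) normr0 expr0n/= !mulr0 lexx.
  have nv : 0 < `|v| by rewrite normr_gt0.
  pose u := `|v|^-1 *: v.
  have u1 : `|u| = 1 by rewrite normrZ normfV normr_id mulVf ?gt_eqF.
  have vu : v = `|v| *: u by rewrite scalerA divff ?gt_eqF// scale1r.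
  have hv : hb t i q v v = `|v| ^+ 2 * hb t i q u u.
    by rewrite {1 2}vu (formZl lin) (formZr lin sym) mulrA.
  have [b1 b2] := VW (q, K) (conj Vq WK) (t, u) (conj Bt u1) dq Bt.
  rewrite /= in b1 b2.
  have n2 : 0 < `|v| ^+ 2 by rewrite exprn_gt0.
  rewrite hv; split.
    by rewrite mulrCA ler_pMr.
  by rewrite mulrC ler_pM2r.
have [b1 b2] := bnd.
have K_ge0 := ltW K_gt0.
rewrite -[ `|v|]normr_id -sqrtr_sqr -!sqrtrM//.
by split; exact: ler_wsqrtr.
Qed.

End comparison.

(** * Concatenation of curves, partitions and integrals *)

Section concatenation.
Context (R : realType).

Lemma ge0_integral_itv_split (f : R -> R) (a m b : R) : a <= m -> m <= b ->
  measurable_fun `[a, b] f -> (forall x, 0 <= f x) ->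
  (\int[lebesgue_measure]_(x in `[a, b]) (f x)%:E =
   \int[lebesgue_measure]_(x in `[a, m]) (f x)%:E +
   \int[lebesgue_measure]_(x in `[m, b]) (f x)%:E)%E.
Proof.
move=> am mb mf f0.
have mf' : measurable_fun `[a, b] (EFin \o f) by exact/measurable_EFinP.
have E : `[a, b]%classic = `[a, m]%classic `|` `]m, b]%classic.
  apply/seteqP; split=> x /=; rewrite !in_itv/=; last by case; lra.
  by move=> xab; have [xm|xm] := leP x m; [left|right]; lra.
rewrite E ge0_integral_setU//=.
- congr (_ + _)%E; rewrite integral_itv_obnd_cbnd//.
  by apply: measurable_funS mf' => //; rewrite E; exact: subsetUr.
- by rewrite -E.
- by move=> x _; rewrite lee_fin.
- by apply/disj_setPS => x [/=]; rewrite !in_itv/=; lra.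
Qed.

Lemma le_ereal_infD (S1 S2 : set (\bar R)) (x : \bar R) :
  (forall y, S1 y -> 0 <= y)%E -> (forall y, S2 y -> 0 <= y)%E ->
  (forall y z, S1 y -> S2 z -> x <= y + z)%E ->
  (x <= ereal_inf S1 + ereal_inf S2)%E.
Proof.
move=> S10 S20 xyz.
have i1 : (0 <= ereal_inf S1)%E by apply: le_ereal_inf_tmp => y /S10.
have i2 : (0 <= ereal_inf S2)%E by apply: le_ereal_inf_tmp => y /S20.
have [->|f1] := eqVneq (ereal_inf S1) +oo%E.
  by rewrite addye ?leey// gt_eqF// (lt_le_trans _ i2)// ltNyr.
have [->|f2] := eqVneq (ereal_inf S2) +oo%E.
  by rewrite addey ?leey// gt_eqF// (lt_le_trans _ i1)// ltNyr.
have F1 : ereal_inf S1 \is a fin_num by rewrite ge0_fin_numE// ltey.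
have F2 : ereal_inf S2 \is a fin_num by rewrite ge0_fin_numE// ltey.
apply/lee_addgt0Pr => e e0.
have e2 : 0 < e / 2 by rewrite divr_gt0.
have [y Sy ylt] := lb_ereal_inf_adherent e2 F1.
have [z Sz zlt] := lb_ereal_inf_adherent e2 F2.
apply: le_trans (xyz _ _ Sy Sz) _.
apply: le_trans (leeD (ltW ylt) (ltW zlt)) _.
by rewrite addeACA -EFinD -splitr.
Qed.

Lemma within_continuous_precomp (T T' U : topologicalType) (X : set T') (f : T' -> U)
    (g : T -> T') : continuous g -> {within X, continuous f} ->
  {within g @^-1` X, continuous (f \o g)}.
Proof.
move=> cg /subspace_continuousP cf; apply/subspace_continuousP => x Xgx.
apply: cvg_comp (cf _ Xgx) => W /= nW.
exact: (cg x _ nW).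
Qed.

Lemma within_continuous_eq (T U : topologicalType) (X : set T) (f g : T -> U) :
  (forall x, X x -> f x = g x) -> {within X, continuous f} -> {within X, continuous g}.
Proof.
by move=> fg; apply: subspace_eq_continuous => x; rewrite inE; exact: fg.
Qed.

(** The parameter of the second curve, defined on an interval starting at
    [a'], is translated so as to start at [b]. *)
Definition cat_curve (P : Type) (b a' : R) (c1 c2 : R -> P) (u : R) : P :=
  if u <= b then c1 u else c2 (a' - b + u *: 1).

Definition cat_partition (m : nat) (b a' : R) (s1 s2 : nat -> R) (k : nat) : R :=
  if (k <= m)%N then s1 k else s2 (k - m)%N - (a' - b).

Lemma is_partition_ge (a b : R) m s j k : is_partition a b m s -> (j <= k <= m)%N ->
  s j <= s k.
Proof.
move=> [_ _ _ lt_s] /andP[]; elim: k => [|k IH]; first by rewrite leqn0 => /eqP ->.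
rewrite leq_eqVlt => /predU1P[->//|]; rewrite ltnS => jk km.
exact: le_trans (IH jk (ltnW km)) (ltW (lt_s _ km)).
Qed.

Lemma cat_partitionR m (b a' b' : R) n s1 s2 k : s1 m = b -> is_partition a' b' n s2 ->
  cat_partition m b a' s1 s2 (m + k)%N = s2 k - (a' - b).
Proof.
move=> sb [_ s20 _ _]; rewrite /cat_partition; case: k => [|k].
  by rewrite addn0 leqnn s20 sb; lra.
by rewrite -[X in (_ <= X)%N]addn0 leq_add2l /= addKn.
Qed.

Lemma is_partition_cat m n (a b a' b' : R) s1 s2 :
  is_partition a b m s1 -> is_partition a' b' n s2 ->
  is_partition a (b' - (a' - b)) (m + n) (cat_partition m b a' s1 s2).
Proof.
move=> p1 p2; have [ab s10 s1m lt1] := p1; have [ab' s20 s2n lt2] := p2.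
split.
- lra.
- by rewrite /cat_partition leq0n.
- by rewrite (cat_partitionR _ s1m p2) s2n.
- move=> k km; have [kltm|mk] := ltnP k m.
    by rewrite /cat_partition (ltnW kltm) kltm; exact: lt1.
  move: km; rewrite -(subnKC mk) ltn_add2l -addnS => km.
  rewrite !(cat_partitionR _ s1m p2); have := lt2 _ km; lra.
Qed.

Lemma cat_curveL (P : Type) (b a' : R) (c1 c2 : R -> P) u : u <= b ->
  cat_curve b a' c1 c2 u = c1 u.
Proof. by rewrite /cat_curve => ->. Qed.

Lemma cat_curveR (P : Type) (b a' : R) (c1 c2 : R -> P) u : c1 b = c2 a' -> b <= u ->
  cat_curve b a' c1 c2 u = c2 (a' - b + u *: 1).
Proof.
rewrite /cat_curve => cc; rewrite le_eqVlt => /predU1P[<-|bu].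
  by rewrite lexx cc; congr c2; rewrite /GRing.scale/= mulr1; lra.
by rewrite leNgt bu.
Qed.

Lemma cat_curve_continuous (P : topologicalType) (a b a' b' : R) (c1 c2 : R -> P) :
  a <= b -> a' <= b' -> c1 b = c2 a' ->
  {within `[a, b], continuous c1} -> {within `[a', b'], continuous c2} ->
  {within `[a, b' - (a' - b)], continuous (cat_curve b a' c1 c2)}.
Proof.
move=> ab ab' cc C1 C2.
have -> : `[a, b' - (a' - b)]%classic = `[a, b]%classic `|` `[b, b' - (a' - b)]%classic.
  apply/seteqP; split=> x /=; rewrite !in_itv/=; last by case; lra.
  by move=> xab; have [xm|xm] := leP x b; [left|right]; lra.
apply: withinU_continuous; [exact: interval_closed|exact: interval_closed| |].
  apply: within_continuous_eq C1 => x /=; rewrite in_itv/= => /andP[_ xb].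
  by rewrite cat_curveL.
have -> : `[b, b' - (a' - b)]%classic = (fun u : R => a' - b + u *: 1) @^-1` `[a', b']%classic.
  by apply/seteqP; split=> x /=; rewrite !in_itv/= /GRing.scale/= mulr1; lra.
apply: within_continuous_eq (within_continuous_precomp _ C2).
  move=> x /=; rewrite !in_itv/= /GRing.scale/= mulr1 => xb.
  by rewrite cat_curveR//; [rewrite /GRing.scale/= mulr1|lra].
exact: (@continuous_affine R (R : normedModType R)).
Qed.

End concatenation.

(** * Straight segments in a chart *)

Section segments.
Context (R : realType) (n : nat) (M : topologicalType) (A : atlas 'rV[R]_n M).
Hypothesis MA : smooth_manifold A.
Let E := 'rV[R]_n.

Lemma chart_ball i p (O : set M) : dom A i p -> nbhs p O ->
  exists2 r : R, 0 < r & forall y : E, `|chart A i p - y| < r ->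
    (chart A i @` dom A i) y /\ O (param A i y).
Proof.
move=> dp nO.
have ip : (chart A i @` dom A i) (chart A i p) by exists p.
have : \forall y \near chart A i p, (chart A i @` dom A i) y /\ O (param A i y).
  apply: filterI; first exact: near_open (manifold_open_img MA i) ip.
  by apply: (manifold_param_cont MA ip); rewrite (manifold_chartK MA).
move=> /nbhs_ballP[r /= r0 H]; exists r => // y yr; apply: H.
by rewrite -ball_normE.
Qed.

Lemma chart_ball_nbhs i p (r : R) : dom A i p -> 0 < r ->
  nbhs p [set q | dom A i q /\ `|chart A i p - chart A i q| < r].
Proof.
move=> dp r0; apply: filterI; first exact: near_open (manifold_open_dom MA i) dp.
have C : chart A i @ p --> chart A i p := manifold_chart_cont MA dp.
apply: (C [set y | `|chart A i p - y| < r]).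
by apply/nbhs_ballP; exists r => //= y; rewrite -ball_normE.
Qed.

Lemma param_dom i (y : E) : (chart A i @` dom A i) y -> dom A i (param A i y).
Proof. by move=> [q dq <-]; rewrite (manifold_chartK MA). Qed.

Lemma paramK i (y : E) : (chart A i @` dom A i) y -> chart A i (param A i y) = y.
Proof. by move=> [q dq <-]; rewrite (manifold_chartK MA). Qed.

Definition chart_segment i (y0 v : E) (u : R) : M := param A i (y0 + u *: v).

(** Read in another chart, a segment is a transition map restricted to a line. *)
Lemma chart_segment_smooth i (y0 v : E) (J : set R) :
  (forall u, J u -> (chart A i @` dom A i) (y0 + u *: v)) ->
  smooth_curve A J (chart_segment i y0 v).
Proof.
move=> JA; split.
- by move=> s _; exact: manifold_cover.
- move=> s Js; apply: (@continuous_comp _ _ _ (fun u : R => y0 + u *: v) (param A i)).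
    exact: continuous_affine.
  exact: manifold_param_cont (JA s Js).
- move=> j k.
  have oU : open (chart A i @` (dom A i `&` dom A j)).
    have -> : chart A i @` (dom A i `&` dom A j) =
        chart A i @` dom A i `&` param A i @^-1` dom A j.
      apply/seteqP; split=> [y [q [di dj] <-]|y [[q di <-]]].
        by split; [exists q|rewrite /= (manifold_chartK MA)].
      by rewrite /= (manifold_chartK MA)// => dj; exists q.
    apply: open_preimage_at; [exact: manifold_open_img|exact: manifold_open_dom|].
    exact: manifold_param_cont.
  have : smooth_on ((fun u : R => y0 + u *: v) @^-1` (chart A i @` (dom A i `&` dom A j)))
      (chart A j \o chart_segment i y0 v).
    by move=> l; exact: Ck_affine y0 v oU (manifold_transition MA i j l).
  move=> /smooth_onW; apply => u [Ju /= du].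
  by have [q di E0] := JA u Ju; exists q; rewrite /= -?E0 //; split => //;
    move: du; rewrite /chart_segment -E0 (manifold_chartK MA).
Qed.

Lemma chart_segment_velocity i (y0 v : E) (J : set R) u : open J -> J u ->
  (forall u, J u -> (chart A i @` dom A i) (y0 + u *: v)) ->
  velocity (A:=A) i (chart_segment i y0 v) u = v.
Proof.
move=> oJ Ju JA; rewrite /velocity.
have D := is_derive_affine y0 v u 1.
rewrite -[RHS]scale1r -(@derive_val _ _ _ _ _ _ _ D).
apply: near_eq_derive; apply: filterS (near_open oJ Ju) => z Jz /=.
by rewrite paramK//; exact: JA.
Qed.

Lemma convex_ball_segment (c y0 y1 : E) (r : R) u : `|c - y0| < r -> `|c - y1| < r ->
  0 <= u <= 1 -> `|c - (y0 + u *: (y1 - y0))| < r.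
Proof.
move=> c0 c1 /andP[u0 u1].
have -> : c - (y0 + u *: (y1 - y0)) = (1 - u) *: (c - y0) + u *: (c - y1).
  by rewrite !scalerBr !scalerBl !scale1r; apply/matrixP => a b; rewrite !mxE; ring.
apply: le_lt_trans (ler_normD _ _) _; rewrite !normrZ.
rewrite (ger0_norm u0) ger0_norm; last lra.
have [->|un0] := eqVneq u 0; first by rewrite mul0r addr0 subr0 mul1r.
have u_gt0 : 0 < u by rewrite lt_neqAle eq_sym un0.
have h1 : (1 - u) * `|c - y0| <= (1 - u) * r by apply: ler_wpM2l; [lra|exact: ltW].
have h2 : u * `|c - y1| < u * r by rewrite ltr_pM2l.
lra.
Qed.

(** A segment between two points of a ball can be prolonged a little at both
    ends without leaving the ball; this room is what smoothness on a closed
    segment requires. *)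
Lemma ball_segment_neigh (c y0 y1 : E) (r : R) : `|c - y0| < r -> `|c - y1| < r ->
  exists2 e : R, 0 < e & forall u : R, `]0 - e, 1 + e[%classic u ->
    `|c - (y0 + u *: (y1 - y0))| < r.
Proof.
move=> c0 c1.
pose U := (fun u : R => y0 + u *: (y1 - y0)) @^-1` (ball c r).
have oU : open U by apply: open_affine_preimage; exact: ball_open.
have inU (u : R) : U u -> `|c - (y0 + u *: (y1 - y0))| < r.
  by rewrite /U /= -ball_normE.
have U01 (u : R) : 0 <= u <= 1 -> U u.
  by move=> u01; rewrite /U /= -ball_normE; exact: convex_ball_segment.
have /nbhs_ballP[e0 /= e00 H0] :=
  @near_open R U 0 oU (U01 0 (introT andP (conj (lexx _) ler01))).
have /nbhs_ballP[e1 /= e10 H1] :=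
  @near_open R U 1 oU (U01 1 (introT andP (conj ler01 (lexx _)))).
exists (Num.min e0 e1); first by rewrite lt_min e00.
move=> u /=; rewrite in_itv/= => /andP[ua ub]; apply: inU.
have ee0 : Num.min e0 e1 <= e0 by rewrite ge_min lexx.
have ee1 : Num.min e0 e1 <= e1 by rewrite ge_min lexx orbT.
have [u0|u0] := ltP u 0.
  by apply: H0; rewrite -ball_normE /= sub0r normrN ltr0_norm//; lra.
have [u1|u1] := ltP 1 u; last by apply: U01; rewrite u0.
by apply: H1; rewrite -ball_normE /= ltr0_norm; lra.
Qed.

End segments.

(** * Riemannian speed *)

Section riemannian.
Context (R : realType) (n : nat) (M : topologicalType) (A : atlas 'rV[R]_n M)
  (T : tensor2 A).
Hypothesis MA : smooth_manifold A.
Hypothesis RT : continuous_riemannian_metric T.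
Let E := 'rV[R]_n.

Lemma constant_family_continuous i (v w : E) :
  {within [set (0 : R)] `*` dom A i, continuous (fun p : R * M => T i p.2 v w)}.
Proof.
apply/subspace_continuousP => -[t q] [/= _ dq].
apply: cvg_within_filter.
apply: (@cvg_comp _ _ _ snd (fun q => T i q v w) _ (nbhs q)); first exact: cvg_snd.
exact: (riem_continuous RT).
Qed.

Lemma riemannian_comparable i p : dom A i p ->
  exists2 K : R, 0 < K & \forall q \near p, forall v : E,
    `|v| <= K * Num.sqrt (T i q v v) /\ Num.sqrt (T i q v v) <= K * `|v|.
Proof.
move=> dp.
have c0 : compact [set (0 : R)] by exact: compact_set1.
have [K K0 nK] := @riemannian_family_comparable R n M A (fun=> T) [set 0] i p MA
  c0 (fun _ _ => RT) (@constant_family_continuous i) dp.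
by exists K => //; apply: filterS nK => q /(_ 0 erefl).
Qed.

Lemma riem_speed_ge0 c s : 0 <= riem_speed T c s.
Proof. exact: sqrtr_ge0. Qed.

(** The speed is defined with a chart that varies with the point; it can be
    computed in any fixed chart, which is what makes it continuous. *)
Lemma riem_speed_chart (J : set R) c s i : open J -> smooth_curve A J c -> J s ->
  dom A i (c s) ->
  riem_speed T c s =
  Num.sqrt (T i (c s) (velocity (A:=A) i c s) (velocity (A:=A) i c s)).
Proof.
move=> oJ cs Js di; rewrite /riem_speed.
have dj : dom A (chart_at A (c s)) (c s) by exact: manifold_cover.
rewrite (tensor2_transition (riem_tensor RT) di dj).
rewrite (velocity_transition (manifold_open_dom MA) (manifold_chartK MA) oJ cs Js di dj)//.
exact: transition_differentiable.
Qed.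

Lemma riem_speed_continuous (J : set R) c s : open J -> smooth_curve A J c -> J s ->
  {for s, continuous (riem_speed T c)}.
Proof.
move=> oJ cs Js.
pose i := chart_at A (c s).
have di : dom A i (c s) by exact: manifold_cover.
have cc := smooth_curve_continuous cs Js.
have nd : \forall u \near s, dom A i (c u).
  exact: cc _ (near_open (manifold_open_dom MA i) di).
pose f u := Num.sqrt (T i (c u) (velocity (A:=A) i c u) (velocity (A:=A) i c u)).
have nf : \forall u \near s, f u = riem_speed T c u.
  apply: filterS2 (near_open oJ Js) nd => u Ju du.
  by rewrite (riem_speed_chart oJ cs Ju du).
change (riem_speed T c @ s --> riem_speed T c s).
rewrite -(nbhs_singleton nf).
apply: cvg_trans (near_eq_cvg nf) _.
apply: (@cvg_comp _ _ _ _ Num.sqrt _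
  (nbhs (T i (c s) (velocity (A:=A) i c s) (velocity (A:=A) i c s))));
  last exact: sqrt_continuous.
have cv := smooth_curve_velocity_continuous cs Js di.
apply: (@tensor_family_cvg R n M A (fun=> T) [set 0] R (nbhs s) _ (fun=> 0)) => //.
- by move=> *; exact: riem_tensor RT.
- exact: constant_family_continuous.
- by apply: filterS nd => u du; split.
- exact: cvg_cst.
Qed.

Lemma riem_speed_eq c c' s : (\forall u \near s, c u = c' u) ->
  riem_speed T c s = riem_speed T c' s.
Proof. by move=> cc; rewrite /riem_speed (nbhs_singleton cc) (velocity_eq _ cc). Qed.

Lemma measurable_riem_speed_itv (a b : R) c :
  smooth_curve A `]a, b[ c -> measurable_fun `]a, b[ (riem_speed T c).
Proof.
move=> cs; apply: open_continuous_measurable_fun; first exact: interval_open.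
by move=> s; rewrite inE => sab; apply: (riem_speed_continuous _ cs) => //; exact: interval_open.
Qed.

Lemma piecewise_smooth_segment (a b : R) c s N : is_partition a b N s ->
  (forall k, (k < N)%N -> exists (e : R) (c' : R -> M),
      [/\ 0 < e, smooth_curve A `]s k - e, s k.+1 + e[ c'
        & forall u, s k <= u <= s k.+1 -> c u = c' u]) ->
  forall k, (k < N)%N -> smooth_curve A `]s k, s k.+1[ c.
Proof.
move=> ps seg k kN; have [e [c' [e0 cs cc']]] := seg k kN.
apply: (@smooth_curve_eq _ _ _ _ (manifold_open_dom MA) _ c').
- exact: interval_open.
- by move=> u /=; rewrite in_itv/= => /andP[u1 u2]; rewrite cc'// !ltW.
- by apply: smooth_curveW cs => u /=; rewrite !in_itv/=; lra.
Qed.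

(** The speed is continuous on each open piece of the partition; the partition
    points, where the derivative may not exist, form a finite set. *)
Lemma measurable_riem_speed (a b : R) c :
  piecewise_smooth A a b c -> measurable_fun `[a, b] (riem_speed T c).
Proof.
move=> [_ [N [s [ps seg]]]].
have [ab s0 sN lt_s] := ps.
suff H k : (k <= N)%N -> measurable_fun `[s 0%N, s k] (riem_speed T c).
  by rewrite -s0 -sN; exact: H.
elim: k => [_|k IH kN]; first by rewrite set_itv1; exact: measurable_fun_set1.
have -> : `[s 0%N, s k.+1]%classic =
    (`[s 0%N, s k] `|` (`]s k, s k.+1[ `|` [set s k.+1]))%classic.
  have sk : s 0%N <= s k by apply: (is_partition_ge ps); rewrite leq0n (ltnW kN).
  have sk1 := lt_s k kN.
  apply/seteqP; split=> x /=; rewrite !in_itv/=.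
    move=> xs; have [xk|xk] := leP x (s k); first by left; lra.
    right; have [xk1|xk1] := ltP x (s k.+1); [by left|right]; lra.
  by move=> [|[|->]]; lra.
apply/measurable_funU => //; first by apply: measurableU => //; exact: measurable_set1.
split; first by apply: IH; exact: ltnW.
apply/measurable_funU => //; split; last exact: measurable_fun_set1.
by apply: measurable_riem_speed_itv; exact: (piecewise_smooth_segment ps).
Qed.

Lemma riem_length_ge0 (a b : R) c : (0 <= riem_length T a b c)%E.
Proof. by apply: integral_ge0 => x _; rewrite lee_fin riem_speed_ge0. Qed.

Lemma riem_dist_ge0 x y : (0 <= riem_dist T x y)%E.
Proof.
by apply: le_ereal_inf_tmp => _ [a [b [c [_ _ _ ->]]]]; exact: riem_length_ge0.
Qed.

End riemannian.

(** * Riemannian distance: upper bound by the chart norm, triangle inequality *)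

Section riemannian_distance.
Context (R : realType) (n : nat) (M : topologicalType) (A : atlas 'rV[R]_n M)
  (T : tensor2 A).
Hypothesis MA : smooth_manifold A.
Hypothesis RT : continuous_riemannian_metric T.
Let E := 'rV[R]_n.

Lemma smooth_curve_within_continuous (J I : set R) (c : R -> M) : I `<=` J ->
  smooth_curve A J c -> {within I, continuous c}.
Proof.
move=> IJ [_ cc _]; apply/subspace_continuousP => s /IJ Js.
apply: cvg_within_filter; exact: cc.
Qed.

(** The straight segment of the chart from x to y has constant velocity
    [chart y - chart x], and its speed is at most K times the norm of that
    vector. *)
Lemma riem_dist_chart_le i p : dom A i p ->
  exists2 K : R, 0 < K & exists2 W : set M, nbhs p W & forall x y, W x -> W y ->
    dom A i x /\ (riem_dist T x y <= (K * `|chart A i x - chart A i y|)%:E)%E.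
Proof.
move=> dp; have [K K0 nK] := riemannian_comparable MA RT dp.
have [r r0 rO] := chart_ball MA dp nK.
exists K => //; exists [set q | dom A i q /\ `|chart A i p - chart A i q| < r].
  exact: chart_ball_nbhs.
move=> x y [dx xr] [dy yr]; split=> //.
have [e e0 He] := ball_segment_neigh xr yr.
set v := chart A i y - chart A i x in He.
pose c := chart_segment i (chart A i x) v.
pose J := `]0 - e, 1 + e[%classic : set R.
have oJ : open J by exact: interval_open.
have J01 : `[0 : R, 1]%classic `<=` J by move=> u; rewrite /J /= !in_itv/=; lra.
have JA u : J u -> (chart A i @` dom A i) (chart A i x + u *: v).
  by move=> /He /rO [].
have cs : smooth_curve A J c by exact: chart_segment_smooth.
have pc : piecewise_smooth A 0 1 c.
  split; first exact: smooth_curve_within_continuous cs.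
  exists 1%N, (fun k => k%:R); split; first by split => // -[|].
  by move=> [|//] _; exists e, c.
apply: (@le_trans _ _ (riem_length T 0 1 c)).
  apply: ereal_inf_lbound; exists 0, 1, c; split=> //.
  - by rewrite /c /chart_segment scale0r addr0 (manifold_chartK MA).
  - by rewrite /c /chart_segment scale1r addrC subrK (manifold_chartK MA).
have -> : (K * `|chart A i x - chart A i y|)%:E =
    (\int[lebesgue_measure]_(s in `[0%R : R, 1%R]) cst (K * `|v|)%:E s)%E.
  rewrite integral_cst//= lebesgue_measure_itv/= lte_fin ltr01 oppr0 adde0 mule1.
  by rewrite /v distrC.
apply: ge0_le_integral => //.
- by move=> s _; rewrite lee_fin riem_speed_ge0.
- by apply/measurable_EFinP; exact: (measurable_riem_speed MA RT pc).
- move=> s /J01 Js; rewrite lee_fin.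
  have ds : dom A i (c s) by apply: (param_dom MA); exact: JA.
  rewrite (riem_speed_chart MA RT oJ cs Js ds) (chart_segment_velocity MA oJ Js JA).
  by have [_ /(_ v) []] := rO _ (He _ Js).
Qed.

Lemma piecewise_smooth_cat (a b a' b' : R) c1 c2 : c1 b = c2 a' ->
  piecewise_smooth A a b c1 -> piecewise_smooth A a' b' c2 ->
  piecewise_smooth A a (b' - (a' - b)) (cat_curve b a' c1 c2).
Proof.
move=> cc [C1 [m [s1 [p1 seg1]]]] [C2 [k [s2 [p2 seg2]]]].
have [ab s10 s1m lt1] := p1; have [ab' s20 s2n lt2] := p2.
split; first by apply: cat_curve_continuous => //; exact: ltW.
exists (m + k)%N, (cat_partition m b a' s1 s2); split; first exact: is_partition_cat.
move=> j jmk; have [jm|mj] := ltnP j m.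
  have [e [c' [e0 cs cc']]] := seg1 j jm; exists e, c'.
  rewrite /cat_partition (ltnW jm) jm; split=> // u uj.
  rewrite cat_curveL ?cc'//; apply: le_trans (_ : s1 j.+1 <= b); first by case/andP: uj.
  by rewrite -s1m; apply: (is_partition_ge p1); rewrite jm leqnn.
move: jmk; rewrite -(subnKC mj) ltn_add2l -addnS => jk.
rewrite !(cat_partitionR _ s1m p2).
have [e [c' [e0 cs cc']]] := seg2 _ jk; exists e, (fun u => c' (a' - b + u *: 1)).
split=> //.
  apply: smooth_curveW (smooth_curve_affine (manifold_open_dom MA) (a' - b) 1 _ cs).
    by move=> u /=; rewrite !in_itv/= /GRing.scale/= mulr1; lra.
  exact: interval_open.
move=> u uj; rewrite cat_curveR//.
  by rewrite cc'// /GRing.scale/= mulr1; lra.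
have : a' <= s2 (j - m)%N by rewrite -s20; apply: (is_partition_ge p2); rewrite leq0n ltnW.
by lra.
Qed.

(** The difference quotients themselves coincide, so this holds at every [u]. *)
Lemma riem_speed_shift c (k u : R) :
  riem_speed T (fun u => c (k + u *: 1)) u = riem_speed T c (u + k).
Proof.
have E0 : k + u *: 1 = u + k by rewrite /GRing.scale/= mulr1 addrC.
rewrite /riem_speed /= E0 /velocity.
set i := chart_at A _.
suff -> : 'D_1 (chart A i \o (fun u0 : R => c (k + u0 *: 1))) u =
  'D_1 (chart A i \o c) (u + k) by [].
rewrite /derive.
set F := (X in lim (X @ _)); set G := (X in _ = lim (X @ _)); suff -> : F = G by [].
rewrite /F /G; apply/funext => l /=.
by rewrite /GRing.scale/= !mulr1 !(addrC k) addrA.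
Qed.

Lemma riem_length_cat (a b a' b' : R) c1 c2 : c1 b = c2 a' ->
  piecewise_smooth A a b c1 -> piecewise_smooth A a' b' c2 ->
  riem_length T a (b' - (a' - b)) (cat_curve b a' c1 c2) =
  (riem_length T a b c1 + riem_length T a' b' c2)%E.
Proof.
move=> cc p1 p2; have pc := piecewise_smooth_cat cc p1 p2.
have ab : a <= b by have [_ [? [? [[/ltW]]]]] := p1.
have ab' : a' <= b' by have [_ [? [? [[/ltW]]]]] := p2.
have mc := measurable_riem_speed MA RT pc.
have m1 := measurable_riem_speed MA RT p1.
have m2 := measurable_riem_speed MA RT p2.
have bb : b <= b' - (a' - b) by lra.
have speed_ge0 c x : 0 <= riem_speed T c x by exact: riem_speed_ge0.
rewrite /riem_length (ge0_integral_itv_split ab bb mc (speed_ge0 _)).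
refine (f_equal2 _ _ _).
- apply: eq_integral_itv_bounded.
  + by apply: measurable_funS mc => // u /=; rewrite !in_itv/=; lra.
  + by apply: measurable_funS m1 => // u /=; rewrite !in_itv/=; lra.
  + move=> u; rewrite in_itv/= => /andP[_ ub]; apply: riem_speed_eq.
    near=> z; rewrite cat_curveL//; apply: ltW; near: z; exact: lt_nbhsl.
- have sh : measurable_fun `[a', b'] (EFin \o riem_speed T c2) by exact/measurable_EFinP.
  have sh0 x : (0 <= (EFin \o riem_speed T c2) x)%E by rewrite lee_fin.
  refine (etrans _ (ge0_integral_itv_shift (a' - b) sh sh0)).
  have -> : a' - (a' - b) = b by lra.
  apply: eq_integral_itv_bounded => [||u].
  + by apply: measurable_funS mc => // u /=; rewrite !in_itv/=; lra.
  + apply: (@measurable_comp _ _ _ _ _ _ `[a', b']%classic) => //.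
    * by move=> _ [u /= + <-]; rewrite !in_itv/=; lra.
    * by apply: measurable_funS (_ : measurable_fun setT _) => //; exact: measurable_funD.
  + rewrite in_itv/= => /andP[bu _]; rewrite -riem_speed_shift; apply: riem_speed_eq.
    near=> z; rewrite cat_curveR//; apply: ltW; near: z; exact: lt_nbhsr.
Unshelve. all: by end_near. Qed.

Lemma riem_dist_triangle x y z :
  (riem_dist T x z <= riem_dist T x y + riem_dist T y z)%E.
Proof.
apply: le_ereal_infD.
- by move=> _ [? [? [? [_ _ _ ->]]]]; exact: riem_length_ge0.
- by move=> _ [? [? [? [_ _ _ ->]]]]; exact: riem_length_ge0.
- move=> _ _ [a [b [c1 [p1 c1a c1b ->]]]] [a' [b' [c2 [p2 c2a c2b ->]]]].
  have cc : c1 b = c2 a' by rewrite c1b.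
  rewrite -(riem_length_cat cc p1 p2).
  have [ab ab'] : a < b /\ a' < b'.
    by have [_ [? [? [[]]]]] := p1; have [_ [? [? [[]]]]] := p2.
  apply: ereal_inf_lbound; exists a, (b' - (a' - b)), (cat_curve b a' c1 c2).
  split=> //; first exact: piecewise_smooth_cat.
    by rewrite cat_curveL// ltW.
  rewrite cat_curveR//; last lra.
  by rewrite -c2b /GRing.scale/= mulr1; congr c2; lra.
Qed.

End riemannian_distance.

(** * Lower bounds of the Riemannian distance *)

Section lower_bound.
Context (R : realType) (n : nat) (M : topologicalType) (A : atlas 'rV[R]_n M)
  (T : tensor2 A).
Hypothesis MA : smooth_manifold A.
Hypothesis RT : continuous_riemannian_metric T.
Let E := 'rV[R]_n.

Lemma row_norm_le (v : E) (r : R) : 0 <= r -> (forall j, `|v 0 j| <= r) -> `|v| <= r.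
Proof.
move=> r0 vr; rewrite [leLHS]/Num.norm /= mx_normrE.
apply: bigmax_le => // -[a b] _ /=; rewrite (ord1 a); exact: vr.
Qed.

Lemma row_norm_ge (v : E) j : `|v 0 j| <= `|v|.
Proof.
rewrite [leRHS]/Num.norm /= mx_normrE.
exact: (le_bigmax _ (fun x : 'I_1 * 'I_n => `|v x.1 x.2|) (0, j)).
Qed.

(** Coordinatewise, the displacement is the integral of the derivative, which
    the norm of the velocity dominates; this norm is at most K times the speed. *)
Lemma chart_displacement_le (J : set R) c i (v w K : R) : open J -> smooth_curve A J c ->
  v <= w -> 0 < K ->
  (forall z, v <= z <= w -> [/\ J z, dom A i (c z) &
     forall e : E, `|e| <= K * Num.sqrt (T i (c z) e e)]) ->
  (`|chart A i (c v) - chart A i (c w)|%:E <=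
   K%:E * \int[lebesgue_measure]_(s in `[v, w]) (riem_speed T c s)%:E)%E.
Proof.
move=> oJ cs vw K0 H.
have cspeed z : v <= z <= w -> {for z, continuous (riem_speed T c)}.
  by move=> /H[Jz _ _]; exact: (riem_speed_continuous MA RT oJ cs Jz).
have mspeed : measurable_fun `[v, w] (riem_speed T c).
  apply: subspace_continuous_measurable_fun => //.
  apply/subspace_continuousP => z /=; rewrite in_itv/= => zvw.
  apply: cvg_within_filter; exact: cspeed.
have speed0 : forall x, `[v, w]%classic x -> (0 <= (riem_speed T c x)%:E)%E.
  by move=> x _; rewrite lee_fin riem_speed_ge0.
have I0 := @integral_ge0 _ _ _ lebesgue_measure `[v, w]%classic
  (fun x => (riem_speed T c x)%:E) speed0.
set I := integral _ _ _ in I0 *.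
suff entry j : ((`|(chart A i (c v) - chart A i (c w)) 0 j|)%:E <= K%:E * I)%E.
  have [->|Ify] := eqVneq I +oo%E; first by rewrite gt0_muley ?leey// lte_fin.
  have If : I \is a fin_num by rewrite ge0_fin_numE// ltey.
  move: entry; rewrite -(fineK If) -EFinM lee_fin => entry.
  apply: row_norm_le; first by rewrite mulr_ge0 ?fine_ge0// ltW.
  by move=> j; rewrite -lee_fin.
move: vw; rewrite le_eqVlt => /predU1P[vw|vw].
  by rewrite vw subrr mxE normr0 mule_ge0// lee_fin ltW.
pose F (z : R) : R := chart A i (c z) 0 j.
pose f (z : R) : R := velocity (A:=A) i c z 0 j.
have dF z : v <= z <= w -> derivable F z 1 /\ 'D_1 F z = f z.
  move=> /H[Jz dz _].
  have D := smooth_curve_derivable cs Jz dz; split; first exact: ((derivable_mxP _ _ _).1 D 0 j).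
  by rewrite /f /velocity derive_mx// mxE.
have cf z : v <= z <= w -> {for z, continuous f}.
  move=> /H[Jz dz _].
  have C := smooth_curve_velocity_continuous cs Jz dz.
  apply: (@cvg_comp _ _ _ _ (fun e : E => e 0 j) _ (nbhs (velocity (A:=A) i c z))) => //.
  exact: coord_continuous.
have wcf : {within `[v, w], continuous f}.
  apply/subspace_continuousP => z /=; rewrite in_itv/= => zvw.
  apply: cvg_within_filter; exact: cf.
have mf : measurable_fun `[v, w] f by exact: subspace_continuous_measurable_fun.
have cF z : v <= z <= w -> {for z, continuous F}.
  by move=> /dF[/derivable1_diffP/differentiable_continuous].
have FTC : (\int[lebesgue_measure]_(x in `[v, w]) (f x)%:E = (F w)%:E - (F v)%:E)%E.
  apply: continuous_FTC2 => //.
    split.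
    - by move=> z; rewrite in_itv/= => /andP[vz zw]; apply: (dF z _).1; rewrite !ltW.
    - by apply: cvg_at_right_filter; apply: cF; rewrite lexx ltW.
    - by apply: cvg_at_left_filter; apply: cF; rewrite lexx ltW.
  by move=> z; rewrite in_itv/= => /andP[vz zw]; rewrite derive1E (dF z _).2// !ltW.
have -> : ((`|(chart A i (c v) - chart A i (c w)) 0 j|)%:E =
    `| \int[lebesgue_measure]_(x in `[v, w]) (f x)%:E |)%E.
  by rewrite FTC -EFinB abse_EFin distrC !mxE.
have mf' : measurable_fun `[v, w] (EFin \o f) by exact/measurable_EFinP.
have mspeed' : measurable_fun `[v, w] (EFin \o riem_speed T c) by exact/measurable_EFinP.
have mI : measurable (`[v, w]%classic : set (measurableTypeR R)) by exact: measurable_itv.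
refine (le_trans (le_abse_integral lebesgue_measure mI mf') _).
have Z := ge0_integralZl lebesgue_measure mI mspeed' speed0 (k := K%:E).
rewrite -(Z _); last by rewrite lee_fin ltW.
refine (ge0_le_integral lebesgue_measure mI _ _ _ _).
- by move=> x _; exact: abse_ge0.
- exact: measurableT_comp.
- by apply: emeasurable_funM => //; exact: measurable_cst.
- move=> z /=; rewrite in_itv/= => zvw; rewrite -EFinM lee_fin.
  have [Jz dz Kz] := H z zvw.
  rewrite (riem_speed_chart MA RT oJ cs Jz dz).
  by apply: le_trans (Kz _); exact: row_norm_ge.
Qed.

End lower_bound.

Section global_distance.
Context (R : realType) (n : nat) (M : topologicalType) (A : atlas 'rV[R]_n M)
  (T : tensor2 A).
Hypothesis MA : smooth_manifold A.
Hypothesis RT : continuous_riemannian_metric T.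
Let E := 'rV[R]_n.

Lemma riem_dist_near (p : M) :
  exists2 W : set M, nbhs p W & forall x y, W x -> W y -> (riem_dist T x y < +oo)%E.
Proof.
have [K K0 [W nW H]] := riem_dist_chart_le MA RT (manifold_cover MA p).
by exists W => // x y Wx Wy; have [_ /le_lt_trans] := H x y Wx Wy; apply; rewrite ltry.
Qed.

(** The points at finite distance of x form a set which is open and closed,
    because the distance is finite between close enough points. *)
Lemma riem_dist_lty : connected [set: M] -> forall x y, (riem_dist T x y < +oo)%E.
Proof.
move=> conn x y.
pose B := [set z | (riem_dist T x z < +oo)%E].
have open_iff z : exists2 W, nbhs z W & forall z', W z' -> B z' <-> B z.
  have [W nW H] := riem_dist_near z; exists W => // z' Wz'.
  have Wz : W z := nbhs_singleton nW.
  split => Bz.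
    apply: le_lt_trans (riem_dist_triangle MA RT x z' z) _.
    by apply: lte_add_pinfty => //; exact: H.
  apply: le_lt_trans (riem_dist_triangle MA RT x z z') _.
  by apply: lte_add_pinfty => //; exact: H.
have oB : open B.
  rewrite openE => z Bz; have [W nW H] := open_iff z.
  by apply: filterS nW => z' /H[_]; apply.
have oCB : open (~` B).
  rewrite openE => z Bz; have [W nW H] := open_iff z.
  by apply: filterS nW => z' /H[h _] /h.
have : B = [set: M].
  apply: conn.
  - have [W nW H] := riem_dist_near x.
    by exists x; apply: H; exact: nbhs_singleton nW.
  - by exists B => //; rewrite setTI.
  - by exists B; rewrite ?setTI//; rewrite -[B]setCK; exact: open_closedC.
by move=> BT; have : B y by rewrite BT.
Qed.

(** Along a curve, the local bound and [chart_displacement_le] compare [phi] with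
    the length of short arcs; [phi] being subadditive and the length additive, the
    comparison is chained along each smooth piece, then over the pieces.
    Compactness provides a constant that does not depend on the curve.  The lemma is
    used with [phi] the supremum over the slices of the null distance, and with
    [phi] the variation of a function that separates two points. *)
Lemma dist_le_riem_dist (phi : M -> M -> \bar R) : compact [set: M] ->
  (forall x y, 0 <= phi x y)%E ->
  (forall x y z, phi x z <= phi x y + phi y z)%E ->
  (forall p, exists2 i, dom A i p & exists2 K : R, 0 < K & exists2 W, nbhs p W &
     forall x y, W x -> W y -> (phi x y <= (K * `|chart A i x - chart A i y|)%:E)%E) ->
  exists2 K : R, 0 < K & forall x y, (phi x y <= K%:E * riem_dist T x y)%E.
Proof.
move=> cM phi0 tri loc.
pose good (K : R) (p : M) := exists i W, [/\ open W, W p, 0 < K,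
  forall x y, W x -> W y -> (phi x y <= (K * `|chart A i x - chart A i y|)%:E)%E &
  forall x, W x -> dom A i x /\ forall v : E, `|v| <= K * Num.sqrt (T i x v v)].
have [K K0 goodK] : exists2 K : R, 0 < K & forall p, good K p.
  apply: compact_uniform_constant => // p.
  have [i di [K1 K10 [W1 nW1 H1]]] := loc p.
  have [K2 K20 nK2] := riemannian_comparable MA RT di.
  pose W := interior (W1 `&` [set q | dom A i q /\ forall v : E,
    `|v| <= K2 * Num.sqrt (T i q v v)]).
  have oW : open W by exact: open_interior.
  have Wp : W p.
    apply: filterI => //; apply: filterI.
      exact: near_open (manifold_open_dom MA i) di.
    by apply: filterS nK2 => q H v; have [] := H v.
  exists (K1 + K2); apply: filterS (near_open oW Wp) => q Wq K KK; exists i, W.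
  have sW := @interior_subset _ (W1 `&` [set q | dom A i q /\ forall v : E,
    `|v| <= K2 * Num.sqrt (T i q v v)]).
  split=> //; first lra.
    move=> x y Wx Wy; have [W1x _] := sW _ Wx; have [W1y _] := sW _ Wy.
    apply: le_trans (H1 _ _ W1x W1y) _; rewrite lee_fin ler_wpM2r//; lra.
  move=> x Wx; have [_ [dx bx]] := sW _ Wx; split => // v.
  by apply: le_trans (bx v) _; rewrite ler_wpM2r ?sqrtr_ge0//; lra.
exists (K * K); first by rewrite mulr_gt0.
move=> x y; rewrite -lee_pdivrMl ?mulr_gt0//.
apply: le_ereal_inf_tmp => _ [a [b [c [pc <- <- ->]]]].
rewrite lee_pdivrMl ?mulr_gt0//.
have mc := measurable_riem_speed MA RT pc.
have [_ [N [s [ps seg]]]] := pc.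
have [ab s0 sN lt_s] := ps.
pose Q (u v : R) : Prop := (phi (c u) (c v) <= (K * K)%:E *
  \int[lebesgue_measure]_(s in `[u, v]) (riem_speed T c s)%:E)%E.
have speed_ge0 : forall x, 0 <= riem_speed T c x by move=> z; exact: riem_speed_ge0.
have Qtrans u v w : a <= u -> u <= v -> v <= w -> w <= b -> Q u v -> Q v w -> Q u w.
  move=> au uv vw wb Quv Qvw; rewrite /Q.
  have mcu : measurable_fun `[u, w] (riem_speed T c).
    by apply: measurable_funS mc => // z /=; rewrite !in_itv/=; lra.
  rewrite (ge0_integral_itv_split uv vw mcu speed_ge0).
  apply: (le_trans (tri _ (c v) _)).
  rewrite ge0_muleDr; first exact: leeD.
    by apply: integral_ge0 => z _; rewrite lee_fin.
  by apply: integral_ge0 => z _; rewrite lee_fin.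
have Qseg k : (k < N)%N -> Q (s k) (s k.+1).
  move=> kN; have [e [c' [e0 cs cc']]] := seg k kN.
  have sk := lt_s k kN.
  have ask : a <= s k by rewrite -s0; apply: (is_partition_ge ps); rewrite leq0n ltnW.
  have skb : s k.+1 <= b by rewrite -sN; apply: (is_partition_ge ps); rewrite kN leqnn.
  apply: (@local_to_global_segment R (s k) (s k.+1) Q); first exact: ltW.
    by move=> u v w u1 uv vw w1; apply: Qtrans => //; lra.
  move=> u uk.
  pose J : set R := `]s k - e, s k.+1 + e[%classic.
  rewrite -/J in cs.
  have oJ : open J by exact: interval_open.
  have Ju : J u by rewrite /J /= in_itv/=; lra.
  have [i [W [oW Wu _ Wphi Wdom]]] := goodK (c' u).
  have nW : \forall z \near u, J z /\ W (c' z).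
    apply: filterI; first exact: (@near_open R J u oJ Ju).
    exact: (smooth_curve_continuous cs Ju (near_open oW Wu)).
  have /nbhs_ballP[d /= d0 Hd] := nW.
  exists d => // v w skv vw wsk vd wd.
  have vwP z : v <= z <= w -> J z /\ W (c' z).
    move=> vzw; apply: Hd; rewrite -ball_normE /= distrC.
    by move: vd wd; rewrite !ltr_norml; lra.
  rewrite /Q cc'; last lra.
  rewrite cc'; last lra.
  apply: le_trans (Wphi _ _ _ _) _; first by apply: (vwP v _).2; rewrite lexx.
    by apply: (vwP w _).2; rewrite lexx andbT.
  have Kge0 : (0 <= K%:E)%E by rewrite lee_fin ltW.
  have -> : (\int[lebesgue_measure]_(s in `[v, w]) (riem_speed T c s)%:E =
    \int[lebesgue_measure]_(s in `[v, w]) (riem_speed T c' s)%:E)%E.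
    apply: eq_integral_itv_bounded.
    - by apply: measurable_funS mc => // z /=; rewrite !in_itv/=; lra.
    - apply: measurable_funS (measurable_riem_speed_itv MA RT cs) => //.
      by move=> z /=; rewrite !in_itv/=; lra.
    - move=> z; rewrite in_itv/= => zvw; apply: riem_speed_eq.
      have : \forall z' \near z, z' \in `]v, w[ by exact: near_in_itvoo.
      by apply: filterS => z'; rewrite in_itv/= => z'vw; apply: cc'; lra.
  rewrite EFinM [(K * K)%:E]EFinM -muleA.
  apply: lee_wpmul2l => //.
  apply: (chart_displacement_le MA RT oJ cs vw K0) => z zvw.
  have [Jz Wz] := vwP z zvw.
  by have [dz bz] := Wdom _ Wz; split.
suff H k : (k <= N)%N -> Q (s 0%N) (s k) by rewrite -s0 -sN; exact: H.
elim: k => [_|k IH kN].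
  rewrite /Q; have [i [W [oW Wu _ Wphi Wdom]]] := goodK (c (s 0%N)).
  apply: le_trans (Wphi _ _ Wu Wu) _.
  rewrite subrr normr0 mulr0 mule_ge0//; first by rewrite lee_fin mulr_ge0// ltW.
  by apply: integral_ge0 => z _; rewrite lee_fin.
apply: Qtrans (IH (ltnW kN)) (Qseg _ kN).
- by rewrite s0.
- by apply: (is_partition_ge ps); rewrite leq0n ltnW.
- exact: ltW (lt_s _ kN).
- by rewrite -sN; apply: (is_partition_ge ps); rewrite kN leqnn.
Qed.

End global_distance.

(** * The Riemannian distance separates points *)

Section separation.
Context (R : realType) (n : nat) (M : topologicalType) (A : atlas 'rV[R]_n M)
  (T : tensor2 A).
Hypothesis MA : smooth_manifold A.
Hypothesis RT : continuous_riemannian_metric T.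
Let E := 'rV[R]_n.

Lemma closed_ball_compact (c : E) (r : R) : compact [set y | `|c - y| <= r].
Proof.
apply: bounded_closed_compact.
  exists (`|c| + r); split; first exact: num_real.
  move=> x xr v /= cv; apply: ltW; apply: le_lt_trans xr.
  have -> : v = c - (c - v) by rewrite opprB addrC subrK.
  by apply: le_trans (ler_normB _ _) _; rewrite lerD2l.
have -> : [set y | `|c - y| <= r] = (fun y : E => `|c - y|) @^-1` [set z | z <= r] by [].
apply: closed_comp => [v _|]; last exact: closed_le.
apply: (@continuous_comp _ _ _ (fun y : E => c - y) Num.norm); last exact: norm_continuous.
by apply: (@continuousB _ _ _ (cst c) id); [exact: cst_continuous|exact: cvg_id].
Qed.

Lemma closed_chart_ball i (c : E) (r : R) :
  (forall y, `|c - y| <= r -> (chart A i @` dom A i) y) ->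
  closed [set q | dom A i q /\ `|c - chart A i q| <= r].
Proof.
move=> sub; apply: compact_closed; first exact: manifold_hausdorff MA.
have -> : [set q | dom A i q /\ `|c - chart A i q| <= r] =
    param A i @` [set y | `|c - y| <= r].
  apply/seteqP; split => [q [dq cq]|_ [y cy <-]].
    by exists (chart A i q) => //; exact: manifold_chartK.
  have iy := sub y cy; split; first exact: param_dom.
  by rewrite (paramK MA iy).
apply: continuous_compact; last exact: closed_ball_compact.
apply/subspace_continuousP => y /sub iy.
apply: cvg_within_filter; exact: (manifold_param_cont MA iy).
Qed.

(** The function equal to the chart distance to x, truncated at r2, and to r2
    outside of the chart, is locally Lipschitz for the charts; so its variation
    between x and y is at most a multiple of the distance, that is, zero. *)
Lemma riem_dist_eq0 x y : compact [set: M] -> riem_dist T x y = 0%E -> x = y.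
Proof.
move=> cM d0.
pose i := chart_at A x; have dx : dom A i x := manifold_cover MA x.
have [r r0 rI] := chart_ball MA dx (filterT (F := nbhs x)).
pose r2 := r / 2.
have r20 : 0 < r2 by rewrite divr_gt0.
pose B := [set q | dom A i q /\ `|chart A i x - chart A i q| <= r2].
(* B is compact, hence closed because the manifold is Hausdorff: so the truncated
   function is constant near each point outside of the chart. *)
have cB : closed B.
  apply: closed_chart_ball => z zr; have [] // := rI z; apply: le_lt_trans zr _.
  by rewrite /r2; lra.
pose rho q := if `[< B q >] then `|chart A i x - chart A i q| else r2.
have rho_dom q : dom A i q -> rho q = Num.min `|chart A i x - chart A i q| r2.
  move=> dq; rewrite /rho; case: asboolP => [[_ h]|h]; first by rewrite min_l.
  by rewrite min_r//; apply: ltW; rewrite ltNge; apply/negP => h'; apply: h.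
pose phi y z := `|rho y - rho z|%:E.
have min_lip (a b c : R) : `|Num.min a c - Num.min b c| <= `|a - b|.
  have := ler_norm (a - b); have := ler_norm (b - a); rewrite distrC => h1 h2.
  rewrite ler_norml; case: (leP a c) => h3; case: (leP b c) => h4; lra.
have [||p|K K0 H] := @dist_le_riem_dist R n M A T MA RT phi cM.
- by move=> u v; rewrite lee_fin.
- by move=> u v w; rewrite -EFinD lee_fin ler_distD.
- have [dp|ndp] := pselect (dom A i p).
    exists i => //; exists 1 => //; exists (dom A i).
      exact: near_open (manifold_open_dom MA i) dp.
    move=> u v du dv; rewrite lee_fin mul1r !rho_dom//.
    apply: le_trans (min_lip _ _ _) _.
    have -> : chart A i u - chart A i v =
       - ((chart A i x - chart A i u) - (chart A i x - chart A i v)).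
      by apply/matrixP => a b; rewrite !mxE; ring.
    by rewrite normrN; exact: ler_dist_dist.
  exists (chart_at A p); first exact: manifold_cover.
  exists 1 => //; exists (~` B).
    by apply: near_open; [exact: closed_openC|move=> -[]].
  move=> u v Bu Bv; rewrite /phi /rho !asboolF// subrr normr0 lee_fin mul1r.
  exact: normr_ge0.
have := H x y; rewrite d0 mule0 lee_fin => h.
have rx : rho x = 0.
  by rewrite rho_dom// subrr normr0 min_l// ltW.
have ry : rho y = 0.
  by move: h; rewrite rx sub0r normrN normr_le0 => /eqP.
move: ry; rewrite /rho; case: asboolP => [[dy _] /eqP|_ r2_0]; last first.
  by rewrite r2_0 ltxx in r20.
rewrite normr_eq0 subr_eq0 => /eqP cxy.
by rewrite -(manifold_chartK MA dx) cxy (manifold_chartK MA).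
Qed.

End separation.

(** * Null distance: triangle inequality and symmetry *)

Section null_distance.
Context (R : realType) (E : normedModType R) (P : topologicalType) (A : atlas E P)
  (g : tensor2 A) (tau : P -> R).
Hypothesis open_dom : forall i, open (dom A i).

Lemma null_length_ge0 n s c : 0 <= null_length tau n s c.
Proof. by apply: sumr_ge0 => k _; exact: normr_ge0. Qed.

Lemma null_dist_ge0 p q : (0 <= null_dist g tau p q)%E.
Proof.
apply: le_ereal_inf_tmp => _ [a [b [n [s [c [_ _ _ ->]]]]]].
by rewrite lee_fin null_length_ge0.
Qed.

Lemma piecewise_causal_cat (a b a' b' : R) m n s1 s2 c1 c2 : c1 b = c2 a' ->
  piecewise_causal g a b m s1 c1 -> piecewise_causal g a' b' n s2 c2 ->
  piecewise_causal g a (b' - (a' - b)) (m + n)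
    (cat_partition m b a' s1 s2) (cat_curve b a' c1 c2).
Proof.
move=> cc [p1 in1 C1 sm1 ca1] [p2 in2 C2 sm2 ca2].
have [ab s10 s1m lt1] := p1; have [ab' s20 s2n lt2] := p2.
have s1b k : (k < m)%N -> s1 k.+1 <= b.
  by move=> km; rewrite -s1m; apply: (is_partition_ge p1); rewrite km leqnn.
have s2a k : (k < n)%N -> a' <= s2 k.
  by move=> kn; rewrite -s20; apply: (is_partition_ge p2); rewrite leq0n ltnW.
have sE k : (m <= k)%N -> (k < m + n)%N -> [/\ (k - m < n)%N,
    cat_partition m b a' s1 s2 k = s2 (k - m)%N - (a' - b) &
    cat_partition m b a' s1 s2 k.+1 = s2 (k - m).+1 - (a' - b)].
  move=> mk; rewrite -{1 3 5}(subnKC mk) ltn_add2l -addnS => kn.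
  by split => //; rewrite (cat_partitionR _ s1m p2).
split.
- exact: is_partition_cat.
- move=> u uab; have [ub|bu] := leP u b.
    by rewrite cat_curveL//; apply: in1; lra.
  by rewrite cat_curveR ?ltW//; apply: in2; rewrite /GRing.scale/= mulr1; lra.
- by apply: cat_curve_continuous => //; exact: ltW.
- move=> k kmn; have [km|mk] := ltnP k m.
    rewrite /cat_partition (ltnW km) km.
    apply: (smooth_curve_eq open_dom _ _ (sm1 _ km)); first exact: interval_open.
    move=> u /=; rewrite in_itv/= => /andP[_ uk]; rewrite cat_curveL//.
    by apply: le_trans (s1b _ km); exact: ltW.
  have [kn -> ->] := sE _ mk kmn.
  apply: (@smooth_curve_eq _ _ _ _ open_dom _ (fun u => c2 (a' - b + u *: 1))).
  + exact: interval_open.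
  + move=> u /=; rewrite in_itv/= => uk; rewrite cat_curveR//.
    have := s2a _ kn; lra.
  + apply: smooth_curveW (smooth_curve_affine open_dom (a' - b) 1 _ (sm2 _ kn)).
      by move=> u /=; rewrite !in_itv/= /GRing.scale/= mulr1; lra.
    exact: interval_open.
- move=> k kmn; have [km|mk] := ltnP k m.
    rewrite /cat_partition (ltnW km) km => u uk i.
    have near_eq : \forall z \near u, c1 z = cat_curve b a' c1 c2 z.
      near=> z; rewrite cat_curveL//; apply: ltW; near: z; apply: lt_nbhsl.
      by have := s1b _ km; lra.
    rewrite -(velocity_eq _ near_eq) -(nbhs_singleton near_eq).
    exact: (ca1 _ km).
  have [kn -> ->] := sE _ mk kmn => u uk i.
  have ak := s2a _ kn.
  have near_eq : \forall z \near u, c2 (a' - b + z *: 1) = cat_curve b a' c1 c2 z.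
    near=> z; rewrite cat_curveR//; apply: ltW; near: z; apply: lt_nbhsr.
    by lra.
  rewrite -(velocity_eq _ near_eq) -(nbhs_singleton near_eq) => du.
  have uk' : s2 (k - m)%N < a' - b + u *: 1 < s2 (k - m).+1.
    by rewrite /GRing.scale/= mulr1; lra.
  rewrite (@velocity_affine _ _ _ _ `]s2 (k - m)%N, s2 (k - m).+1[%classic) //; last exact: sm2.
  by rewrite scale1r; exact: (ca2 _ kn).
Unshelve. all: by end_near. Qed.

Lemma null_length_cat (a b a' b' : R) m n s1 s2 (c1 c2 : R -> P) : c1 b = c2 a' ->
  is_partition a b m s1 -> is_partition a' b' n s2 ->
  null_length tau (m + n) (cat_partition m b a' s1 s2) (cat_curve b a' c1 c2) =
  null_length tau m s1 c1 + null_length tau n s2 c2.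
Proof.
move=> cc p1 p2; have [ab s10 s1m lt1] := p1; have [ab' s20 s2n lt2] := p2.
have cL k : (k <= m)%N ->
    cat_curve b a' c1 c2 (cat_partition m b a' s1 s2 k) = c1 (s1 k).
  move=> km; rewrite /cat_partition km cat_curveL// -s1m.
  by apply: (is_partition_ge p1); rewrite km leqnn.
have cR k : (k <= n)%N ->
    cat_curve b a' c1 c2 (cat_partition m b a' s1 s2 (m + k)) = c2 (s2 k).
  move=> kn; rewrite (cat_partitionR _ s1m p2) cat_curveR//.
    by congr c2; rewrite /GRing.scale/= mulr1; lra.
  have : a' <= s2 k by rewrite -s20; apply: (is_partition_ge p2); rewrite leq0n.
  lra.
rewrite /null_length big_split_ord /=; congr (_ + _); apply: eq_bigr => k _.
  by rewrite !cL//; exact: ltnW.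
by rewrite -addnS !cR//; exact: ltnW.
Qed.

Lemma null_dist_triangle p q r :
  (null_dist g tau p r <= null_dist g tau p q + null_dist g tau q r)%E.
Proof.
apply: le_ereal_infD.
- by move=> _ [a [b [n [s [c [_ _ _ ->]]]]]]; rewrite lee_fin null_length_ge0.
- by move=> _ [a [b [n [s [c [_ _ _ ->]]]]]]; rewrite lee_fin null_length_ge0.
move=> _ _ [a [b [m [s1 [c1 [p1 c1a c1b ->]]]]]] [a' [b' [n [s2 [c2 [p2 c2a c2b ->]]]]]].
have cc : c1 b = c2 a' by rewrite c1b.
have [q1 q2] := (pcausal_partition p1, pcausal_partition p2).
rewrite -EFinD -(null_length_cat cc q1 q2).
have [ab ab'] : a < b /\ a' < b' by case: q1; case: q2.
apply: ereal_inf_lbound; exists a, (b' - (a' - b)), (m + n)%N.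
exists (cat_partition m b a' s1 s2), (cat_curve b a' c1 c2); split=> //.
- exact: piecewise_causal_cat.
- by rewrite cat_curveL// ltW.
- rewrite cat_curveR//; last lra.
  by rewrite -c2b; congr c2; rewrite /GRing.scale/= mulr1; lra.
Qed.

Hypothesis g_even : forall i p, dom A i p -> forall v, g i p (- v) (- v) = g i p v v.

Lemma piecewise_causal_rev (a b : R) n s c : piecewise_causal g a b n s c ->
  piecewise_causal g (- b) (- a) n (fun k => - s (n - k)%N) (fun u => c (0 + u *: (-1))).
Proof.
move=> [p1 in1 C1 sm1 ca1]; have [ab s0 sn lt_s] := p1.
have rE (u : R) : 0 + u *: (-1) = - u by rewrite /GRing.scale/= mulrN1 add0r.
have kE k : (k < n)%N -> [/\ (n - k.+1 < n)%N & (n - k = (n - k.+1).+1)%N].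
  by move=> kn; rewrite !subnSK// leq_subr.
split.
- split; [lra|by rewrite subn0 sn|by rewrite subnn s0|].
  by move=> k /kE[kn ->]; rewrite ltrN2; exact: lt_s.
- by move=> u uab; rewrite rE; apply: in1; lra.
- have -> : `[- b, - a]%classic = (fun u : R => 0 + u *: (-1)) @^-1` `[a, b]%classic.
    by apply/seteqP; split=> u /=; rewrite !in_itv/= rE; lra.
  apply: within_continuous_precomp C1; exact: (@continuous_affine R (R : normedModType R)).
- move=> k /kE[kn ->].
  apply: smooth_curveW (smooth_curve_affine open_dom 0 (-1) _ (sm1 _ kn)).
    by move=> u /=; rewrite !in_itv/= rE; lra.
  exact: interval_open.
- move=> k /kE[kn ->] u uk i du.
  have uk' : s (n - k.+1)%N < (0 + u *: (-1) : R) < s (n - k.+1).+1 by rewrite rE; lra.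
  rewrite (@velocity_affine _ _ _ _ `]s (n - k.+1)%N, s (n - k.+1).+1[%classic) //; last exact: sm1.
  rewrite scaleN1r /causal /timelike /null g_even//.
  case: (ca1 _ kn _ uk' i du) => [?|[v0 ?]]; [by left|right; split => //].
  by move/eqP; rewrite oppr_eq0 => /eqP.
Qed.

(** Segments may be past or future directed, so a piecewise causal curve can be
    run backwards. *)
Lemma null_dist_sym_le p q : (null_dist g tau q p <= null_dist g tau p q)%E.
Proof.
apply: le_ereal_inf_tmp => _ [a [b [n [s [c [pc ca cb ->]]]]]].
have rE (u : R) : 0 + u *: (-1) = - u by rewrite /GRing.scale/= mulrN1 add0r.
apply: ereal_inf_lbound; exists (- b), (- a), n, (fun k => - s (n - k)%N).
exists (fun u => c (0 + u *: (-1))); split.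
- exact: piecewise_causal_rev.
- by rewrite rE opprK.
- by rewrite rE opprK.
congr (_%:E); rewrite /null_length (reindex_inj rev_ord_inj) /=.
apply: eq_bigr => k _; rewrite !rE !opprK distrC.
by rewrite subnSK// subKn// ltnW.
Qed.

End null_distance.

(** * Causal curves above straight segments *)

Section product_curve.
Context (R : realType) (n : nat) (M : topologicalType) (A : atlas 'rV[R]_n M)
  (I : set R).
Hypothesis MA : smooth_manifold A.

Lemma smooth_curve_product (J : set R) (t w : R) (c : R -> M) :
  smooth_curve A J c -> open J -> (forall u, J u -> I (t + u *: w)) ->
  smooth_curve (product_atlas I A) J (fun u => (t + u *: w, c u)).
Proof.
move=> [cd cc cs] oJ JI; split.
- by move=> u Ju; split => /=; [exact: JI|exact: cd].
- move=> u Ju.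
  apply: (@cvg_pair _ _ _ (nbhs u) (nbhs (t + u *: w)) (nbhs (c u)) _ _ _
    (fun u => t + u *: w) c).
    exact: (@continuous_affine R (R : normedModType R)).
  exact: cc.
- move=> i.
  apply: (@smooth_onW _ _ _ (J `&` c @^-1` dom A i)).
    by move=> u [Ju [_ /= du]].
  move=> k.
  have oU : open (J `&` c @^-1` dom A i).
    by apply: open_preimage_at => //; exact: manifold_open_dom.
  apply: (@Ck_pair R R 'rV[R]_n k _ (fun u => t + u *: w) (chart A i \o c) oU); last exact: cs.
  have : smooth_on ((fun u : R => t + u *: w) @^-1` setT) (fun u : R => t + u *: w).
    by move=> l; exact: @Ck_affine R R R l setT id t w openT (@Ck_id R R l setT).
  by move=> /smooth_onW; apply.
Qed.

End product_curve.

Section cosmological.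
Context (R : realType) (n : nat) (M : topologicalType) (A : atlas 'rV[R]_n M)
  (tmax : R) (h : tensor2 (cosmo_atlas A tmax)) (hbar : R -> tensor2 A).
Hypothesis Hc : cosmological_spacetime h.
Hypothesis Hx : extends_continuously h hbar.
Let MA := cosmo_manifold Hc.
Let NA := cosmo_atlas A tmax.
Let g := cosmo_metric h.
Let dh := cosmo_null_dist h.
Let E := 'rV[R]_n.

Lemma cosmo_open_dom i : open (dom NA i).
Proof. by apply: product_atlas_open_dom => //; exact: interval_open. Qed.

Lemma cosmo_metric_even i p : dom NA i p -> forall v, g i p (- v) (- v) = g i p v v.
Proof.
move=> dp v.
have lin := tensor2_linear (cosmo_tensor Hc) dp.
have sym := tensor2_sym (cosmo_tensor Hc) dp.
have hN u w : h i p (- u) w = - h i p u w.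
  by have := formZl lin (-1) u w; rewrite scaleN1r mulN1r.
by rewrite /g /cosmo_metric hN sym hN opprK /= mulrNN.
Qed.

Lemma cosmo_metric_slice i (t : R) x (a : R) (v : E) : 0 < t < tmax -> dom A i x ->
  g i (t, x) (a, v) (a, v) = - (a * a) + hbar t i x v v.
Proof. by move=> t0 dx; rewrite /g /cosmo_metric/= (cosmo_slice_form Hc Hx _ _ _ _ t0 dx). Qed.

(** Causality of a velocity can be checked in one chart. *)
Lemma cosmo_metric_transition (J : set R) i j c u : open J -> smooth_curve NA J c -> J u ->
  dom NA i (c u) -> dom NA j (c u) ->
  g j (c u) (velocity (A:=NA) j c u) (velocity (A:=NA) j c u) =
  g i (c u) (velocity (A:=NA) i c u) (velocity (A:=NA) i c u) /\
  (velocity (A:=NA) i c u != 0 -> velocity (A:=NA) j c u != 0).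
Proof.
move=> oJ cs Ju di dj.
have K i0 p : dom NA i0 p -> param NA i0 (chart NA i0 p) = p :=
  @product_atlas_chartK _ _ _ _ MA _ i0 p.
have D i0 j0 : dom NA i0 (c u) -> dom NA j0 (c u) ->
    differentiable (chart NA j0 \o param NA i0) (chart NA i0 (c u)).
  by move=> [_ d1] [_ d2]; exact: product_transition_differentiable.
have V := velocity_transition cosmo_open_dom K oJ cs Ju di dj (D _ _ di dj).
have V' := velocity_transition cosmo_open_dom K oJ cs Ju dj di (D _ _ dj di).
split; last by apply: contra_neq => V0; rewrite V' V0 linear0.
rewrite V /g /cosmo_metric -(tensor2_transition (cosmo_tensor Hc) di dj).
by rewrite (diff_product_transition MA _ _ di.2 dj.2).
Qed.

Lemma hbar_comparable i p : dom A i p ->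
  exists2 K : R, 0 < K & \forall q \near p, forall t, 0 <= t <= tmax -> forall v : E,
    `|v| <= K * Num.sqrt (hbar t i q v v) /\ Num.sqrt (hbar t i q v v) <= K * `|v|.
Proof.
move=> dp.
have cB : compact `[0, tmax]%classic by exact: segment_compact.
have RB s : `[0, tmax]%classic s -> continuous_riemannian_metric (hbar s).
  by rewrite /= in_itv/=; exact: (slice_riemannian Hc Hx).
have [K K0 nK] := riemannian_family_comparable MA cB RB (@ext_continuous _ _ _ _ _ _ _ Hx i) dp.
by exists K => //; apply: filterS nK => q H t t0; apply: H; rewrite /= in_itv.
Qed.

(** Lift the straight segment from x to y with the time component running
    linearly from t to s.  The velocity is (s - t, v) with v the displacement in the
    chart, and it is causal because the slice norm of v is at most K |v| <= |s - t|.
    The null length of this single causal segment is |t - s|. *)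
Lemma cosmo_chart_step i p : dom A i p ->
  exists2 K : R, 0 < K & exists2 W : set M, nbhs p W & forall x y, W x -> W y ->
    forall t s, 0 < t < tmax -> 0 < s < tmax -> t != s ->
    K * `|chart A i x - chart A i y| <= `|t - s| ->
    (dh (t, x) (s, y) <= `|t - s|%:E)%E.
Proof.
move=> dp; have [K K0 nK] := hbar_comparable dp.
have [r r0 rO] := chart_ball MA dp nK.
exists K => //; exists [set q | dom A i q /\ `|chart A i p - chart A i q| < r].
  exact: chart_ball_nbhs.
move=> x y [dx xr] [dy yr] t s t0 s0 ts Kts.
have [e e0 He] := ball_segment_neigh xr yr.
set v := chart A i y - chart A i x in He.
pose c := chart_segment (A:=A) i (chart A i x) v.
pose J : set R := `]0 - e, 1 + e[%classic.
pose J1 : set R := `]0, 1[%classic.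
have oJ : open J by exact: interval_open.
have oJ1 : open J1 by exact: interval_open.
have J01 : `[0 : R, 1]%classic `<=` J by move=> u; rewrite /J /= !in_itv/=; lra.
have JJ1 : J1 `<=` J by move=> u; rewrite /J /J1 /= !in_itv/=; lra.
have JA u : J u -> (chart A i @` dom A i) (chart A i x + u *: v).
  by move=> /He /rO [].
have cs : smooth_curve A J c by exact: chart_segment_smooth.
pose al (u : R) : R * M := (t + u *: (s - t), c u).
have tu (u : R) : 0 <= u <= 1 -> 0 < t + u *: (s - t) < tmax.
  move=> u01; rewrite /GRing.scale/=; nra.
have als : smooth_curve NA J1 al.
  apply: smooth_curve_product => //; first exact: smooth_curveW cs.
  by move=> u; rewrite /J1 /= !in_itv/= => /andP[u0 u1]; apply: tu; rewrite !ltW.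
have ds u : J u -> dom A i (c u) by move=> Ju; apply: (param_dom MA); exact: JA.
have vel u : J1 u -> velocity (A:=NA) i al u = (s - t, v).
  move=> J1u; have Ju := JJ1 _ J1u.
  rewrite /velocity (@derive_pair R R E (fun u : R => t + u *: (s - t)) (chart A i \o c)).
  - congr (_, _); last exact: chart_segment_velocity oJ Ju JA.
    have D := @is_derive_affine R R t (s - t) u 1.
    by rewrite derive_val scale1r.
  - have D := @is_derive_affine R R t (s - t) u 1; exact: ex_derive.
  - exact: (smooth_curve_derivable cs Ju (ds _ Ju)).
have pc : piecewise_causal g 0 1 1 (fun k => k%:R) al.
  split.
  - by split => // -[|].
  - by move=> u u01; split => /=; [rewrite in_itv; exact: tu|exact: manifold_cover].
  - apply/subspace_continuousP => u u01; apply: cvg_within_filter.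
    apply: (@cvg_pair _ _ _ (nbhs u) (nbhs (t + u *: (s - t))) (nbhs (c u))
      _ _ _ (fun u => t + u *: (s - t)) c).
      exact: (@continuous_affine R (R : normedModType R)).
    exact: (smooth_curve_continuous cs (J01 _ u01)).
  - by move=> [|//] _.
  - move=> [|//] _ u u01 j dj.
    have J1u : J1 u by rewrite /J1 /= in_itv.
    have di : dom NA i (al u) by split; [case: dj|exact/ds/JJ1].
    have [gE vE] := cosmo_metric_transition oJ1 als J1u di dj.
    have v0 : velocity (A:=NA) j al u <> 0.
      apply/eqP/vE; rewrite vel//; apply/eqP => -[/eqP].
      by rewrite subr_eq0 eq_sym (negbTE ts).
    have u01' : 0 <= u <= 1 by case/andP: u01 => /ltW -> /ltW ->.
    have tuu : 0 < t + u *: (s - t) < tmax by exact: tu.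
    have diu : dom A i (c u) by apply: ds; exact: JJ1.
    have gS := cosmo_metric_slice (s - t) v tuu diu.
    rewrite /causal /timelike /null gE (vel _ J1u) gS.
    set tau := t + _; set q := c u.
    have [_ /(_ tau _ v)] := rO _ (He _ (JJ1 _ J1u)).
    have tau01 : 0 <= tau <= tmax by case/andP: tuu => /ltW -> /ltW ->.
    move=> /(_ tau01) [_]; rewrite -[param _ _ _]/q => hv.
    have H0 : 0 <= hbar tau i q v v.
      have [->|vn0] := eqVneq v 0; last first.
        by apply: ltW; apply: riem_posdef vn0; [exact: (slice_riemannian Hc Hx)|exact/ds/JJ1].
      have ST := riem_tensor (slice_riemannian Hc Hx tau01).
      by rewrite (form0l (tensor2_linear ST (ds _ (JJ1 _ J1u)))).
    have hts : Num.sqrt (hbar tau i q v v) <= `|t - s|.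
      by apply: le_trans hv _; rewrite /v distrC.
    have : hbar tau i q v v <= (s - t) * (s - t).
      rewrite -expr2 -real_normK ?num_real// distrC -(sqr_sqrtr H0).
      by rewrite ler_sqr// nnegrE// sqrtr_ge0.
    (* Equality gives a null vector, which is nonzero since t and s differ. *)
    rewrite le_eqVlt => /predU1P[hE|lt].
      by right; split => //; rewrite hE addNr.
    by left; rewrite addrC subr_lt0.
apply: ereal_inf_lbound; exists 0, 1, 1%N, (fun k => k%:R), al; split => //.
- by rewrite /al scale0r addr0 /c /chart_segment scale0r addr0 (manifold_chartK MA).
- rewrite /al scale1r addrC subrK /c /chart_segment scale1r (addrC (chart A i x)) subrK.
  by rewrite (manifold_chartK MA).
- rewrite /null_length big_ord_recl big_ord0 addr0 /= /al /= scale0r scale1r addr0.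
  by rewrite [in LHS]distrC; congr (`|_|%:E); ring.
Qed.

End cosmological.

(** * The null distance is bounded by the product distance *)

Section null_distance_bounds.
Context (R : realType) (n : nat) (M : topologicalType) (A : atlas 'rV[R]_n M)
  (tmax : R) (h : tensor2 (cosmo_atlas A tmax)) (hbar : R -> tensor2 A).
Hypothesis Hc : cosmological_spacetime h.
Hypothesis Hx : extends_continuously h hbar.
Hypothesis cM : compact [set: M].
Let MA := cosmo_manifold Hc.
Let T0 := cosmo_tmax Hc.
Let dh := cosmo_null_dist h.

Lemma cosmo_null_dist_ge0 p q : (0 <= dh p q)%E.
Proof. exact: null_dist_ge0. Qed.

Lemma cosmo_null_dist_triangle p q r : (dh p r <= dh p q + dh q r)%E.
Proof. by apply: null_dist_triangle => i; exact: (cosmo_open_dom Hc). Qed.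

Lemma cosmo_null_dist_sym p q : dh p q = dh q p.
Proof.
by apply/eqP; rewrite eq_le; apply/andP; split; apply: null_dist_sym_le => i;
  (exact: (cosmo_open_dom Hc)) || (exact: (cosmo_metric_even Hc)).
Qed.

(** Go from (t, x) to (t', y) and back to (t, y), where |t - t'| = del is large
    enough for the first step to be causal; the second one is vertical.  The null
    length is 2 del.  The neighbourhood is small enough for t + del or t - del to
    remain between 0 and tmax. *)
Lemma cosmo_slice_near (p : M) i : dom A i p -> exists2 K : R, 0 < K &
  exists2 W : set M, nbhs p W & forall x y, W x -> W y ->
    forall t, 0 < t < tmax -> (dh (t, x) (t, y) <= (K * `|chart A i x - chart A i y|)%:E)%E.
Proof.
move=> dp; have [K K0 [W nW HW]] := cosmo_chart_step Hc Hx dp.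
exists (2 * K); first by rewrite mulr_gt0.
pose r := tmax / (8 * K).
have r0 : 0 < r by rewrite divr_gt0 ?mulr_gt0.
exists (W `&` [set q | dom A i q /\ `|chart A i p - chart A i q| < r]).
  by apply: filterI => //; exact: chart_ball_nbhs.
move=> x y [Wx [dx xr]] [Wy [dy yr]] t t01.
set D := `|chart A i x - chart A i y|.
have D0 : 0 <= D by exact: normr_ge0.
have KD : K * D < tmax / 4.
  have Dr : D < r + r.
    rewrite /D -(subrK (chart A i p) (chart A i x)) -addrA.
    by apply: le_lt_trans (ler_normD _ _) _; rewrite distrC ltrD.
  have -> : tmax / 4 = K * (r + r) by rewrite /r; field; rewrite gt_eqF.
  by rewrite ltr_pM2l.
have KD0 : 0 <= K * D by rewrite mulr_ge0// ltW.
have zig del : 0 < del -> K * D <= del -> del < tmax / 2 ->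
    (dh (t, x) (t, y) <= (2 * del)%:E)%E.
  move=> del0 Kdel delT.
  have [t' [t'01 tt']] : exists t', 0 < t' < tmax /\ `|t - t'| = del.
    have [tT|tT] := ltP (t + del) tmax.
      exists (t + del); split; first by lra.
      by rewrite opprD addNKr normrN gtr0_norm.
    exists (t - del); split; first by lra.
    by rewrite subKr gtr0_norm.
  have ntt' : t != t' by rewrite -subr_eq0 -normr_eq0 tt' gt_eqF.
  apply: le_trans (cosmo_null_dist_triangle _ (t', y) _) _.
  have -> : (2 * del)%:E = (del%:E + del%:E)%E by rewrite -EFinD; congr (_%:E); lra.
  apply: leeD.
    by rewrite -tt'; apply: HW => //; rewrite tt'.
  rewrite -tt' distrC; apply: HW => //; first by rewrite eq_sym.
  by rewrite subrr normr0 mulr0.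
apply/lee_addgt0Pr => e e0; rewrite -EFinD.
(* The extra term keeps del positive when the two points coincide. *)
pose del := K * D + Num.min (e / 2) (tmax / 8).
have m1 : Num.min (e / 2) (tmax / 8) <= e / 2 by rewrite ge_min lexx.
have m2 : Num.min (e / 2) (tmax / 8) <= tmax / 8 by rewrite ge_min lexx orbT.
have m0 : 0 < Num.min (e / 2) (tmax / 8) by rewrite lt_min !divr_gt0.
have T0' := T0.
have del0 : 0 < del by rewrite /del; lra.
have Kdel : K * D <= del by rewrite /del; lra.
have delT : del < tmax / 2 by rewrite /del; lra.
apply: le_trans (zig del del0 Kdel delT) _.
by rewrite lee_fin /del; lra.
Qed.

Lemma cosmo_null_dist_vertical x t s : 0 < t < tmax -> 0 < s < tmax ->
  (dh (t, x) (s, x) <= `|t - s|%:E)%E.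
Proof.
move=> t0 s0; have dx := manifold_cover MA x.
have [ts|ts] := eqVneq t s.
  have [K K0 [W nW HW]] := cosmo_slice_near dx.
  have Wx := nbhs_singleton nW.
  by have := HW _ _ Wx Wx _ t0; rewrite -ts !subrr !normr0 mulr0.
have [K K0 [W nW HW]] := cosmo_chart_step Hc Hx dx.
have Wx := nbhs_singleton nW.
by apply: HW => //; rewrite subrr normr0 mulr0.
Qed.

(** Move vertically, then inside a slice.  To get a constant independent of the
    slice, [dist_le_riem_dist] is applied to the supremum over all slices. *)
Lemma cosmo_null_dist_le t0 : 0 <= t0 <= tmax ->
  exists2 K : R, 0 < K & forall p q, cosmo_space M tmax p -> cosmo_space M tmax q ->
    (dh p q <= K%:E * product_dist hbar t0 p q)%E.
Proof.
move=> t01; have RT := slice_riemannian Hc Hx t01.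
pose phi x y := ereal_sup [set dh (t, x) (t, y) | t in `]0, tmax[%classic].
have phi_ub t x y : 0 < t < tmax -> (dh (t, x) (t, y) <= phi x y)%E.
  by move=> tt; apply: ereal_sup_ubound; exists t => //=; rewrite in_itv.
have T2 : 0 < tmax / 2 < tmax by have := T0; lra.
have phi0 x y : (0 <= phi x y)%E.
  by apply: le_trans (phi_ub _ x y T2); exact: cosmo_null_dist_ge0.
have tri x y z : (phi x z <= phi x y + phi y z)%E.
  apply: ge_ereal_sup => _ [t /= tt <-]; rewrite in_itv/= in tt.
  apply: le_trans (cosmo_null_dist_triangle _ (t, y) _) _.
  by apply: leeD; exact: phi_ub.
have [|K K0 HK] := @dist_le_riem_dist R n M A (hbar t0) MA RT phi cM phi0 tri.
  move=> p; have dp := manifold_cover MA p; exists (chart_at A p) => //.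
  have [K K0 [W nW HW]] := cosmo_slice_near dp; exists K => //; exists W => //.
  move=> x y Wx Wy; apply: ge_ereal_sup => _ [t /= tt <-]; rewrite in_itv/= in tt.
  exact: HW.
exists (1 + K); first lra.
move=> [t x] [s y] [/= t1 _] [/= s1 _]; rewrite !in_itv/= in t1 s1.
apply: le_trans (cosmo_null_dist_triangle _ (s, x) _) _.
rewrite /product_dist /= ge0_muleDr ?lee_fin//; last exact: riem_dist_ge0.
apply: leeD.
  apply: le_trans (cosmo_null_dist_vertical _ t1 s1) _.
  rewrite -EFinM lee_fin; have := normr_ge0 (t - s); nra.
apply: le_trans (phi_ub _ _ _ s1) _.
apply: le_trans (HK _ _) _.
apply: lee_wpmul2r; first exact: riem_dist_ge0.
by rewrite lee_fin; lra.
Qed.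

End null_distance_bounds.

(** * Along a causal curve, time controls the displacement in the slice *)

Section causal_curves.
Context (R : realType) (n : nat) (M : topologicalType) (A : atlas 'rV[R]_n M)
  (tmax : R) (h : tensor2 (cosmo_atlas A tmax)) (hbar : R -> tensor2 A).
Hypothesis Hc : cosmological_spacetime h.
Hypothesis Hx : extends_continuously h hbar.
Let MA := cosmo_manifold Hc.
Let NA := cosmo_atlas A tmax.
Let g := cosmo_metric h.
Let E := 'rV[R]_n.

Lemma product_velocity (J : set R) c i u : smooth_curve NA J c -> J u -> dom NA i (c u) ->
  [/\ derivable (fun z => (c z).1) u 1, derivable (fun z => chart A i (c z).2) u 1 &
   velocity (A:=NA) i c u = ('D_1 (fun z => (c z).1) u, 'D_1 (fun z => chart A i (c z).2) u)].
Proof.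
move=> cs Ju du.
have D := smooth_curve_derivable cs Ju du.
have dD : differentiable (chart NA i \o c) u by apply/derivable1_diffP.
have d1 : derivable (fun z => (c z).1) u 1.
  apply/derivable1_diffP.
  apply: (@differentiable_comp _ _ _ _ (chart NA i \o c) fst) => //; exact: differentiable_fst.
have d2 : derivable (fun z => chart A i (c z).2) u 1.
  apply/derivable1_diffP.
  apply: (@differentiable_comp _ _ _ _ (chart NA i \o c) snd) => //; exact: differentiable_snd.
split=> //.
by rewrite -(@derive_pair R R E (fun z => (c z).1) (fun z => chart A i (c z).2)).
Qed.

(** A causal velocity (a, w) satisfies h(w, w) <= a^2; if a were zero then w
    would be zero too, and the zero vector is not causal. *)
Lemma causal_velocity (J : set R) c i u (K : R) : smooth_curve NA J c -> J u ->
  dom NA i (c u) -> causal (g i (c u)) (velocity (A:=NA) i c u) ->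
  0 < K -> (forall v : E, `|v| <= K * Num.sqrt (hbar (c u).1 i (c u).2 v v)) ->
  'D_1 (fun z => (c z).1) u != 0 /\
  `|'D_1 (fun z => chart A i (c z).2) u| <= K * `|'D_1 (fun z => (c z).1) u|.
Proof.
move=> cs Ju du cau K0 HK.
have [_ _ VE] := product_velocity cs Ju du.
move: cau; rewrite VE; set a := 'D_1 _ u; set w := 'D_1 _ u.
have [du1 du2] := du; rewrite /= in_itv/= in du1.
have gS := cosmo_metric_slice Hc Hx a w du1 du2.
rewrite -surjective_pairing in gS.
rewrite /causal /timelike /null /g gS => cau.
have hb : hbar (c u).1 i (c u).2 w w <= a ^+ 2.
  by rewrite expr2; case: cau => [|[_]]; lra.
have wa : `|w| <= K * `|a|.
  apply: le_trans (HK w) _; rewrite ler_pM2l//.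
  by rewrite -sqrtr_sqr; exact: ler_wsqrtr.
split=> //; apply/eqP => a0.
move: wa; rewrite a0 normr0 mulr0 normr_le0 => /eqP w0.
case: cau => [|[]]; last by rewrite a0 w0.
rewrite a0 w0 mulr0 oppr0 add0r.
have t01 : 0 <= (c u).1 <= tmax by case/andP: du1 => /ltW -> /ltW ->.
have ST := riem_tensor (slice_riemannian Hc Hx t01).
by rewrite (form0l (tensor2_linear ST du2)) ltxx.
Qed.

(** The time derivative is continuous and does not vanish on the open segment,
    so its sign [e] is constant. *)
Lemma causal_time_monotone (a b : R) c : a < b -> smooth_curve NA `]a, b[ c ->
  (forall u, a < u < b -> forall i, dom NA i (c u) ->
     causal (g i (c u)) (velocity (A:=NA) i c u)) ->
  exists e : R, `|e| = 1 /\ forall u, a < u < b -> 0 < e * 'D_1 (fun z => (c z).1) u.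
Proof.
move=> ab cs cau.
pose th' u := 'D_1 (fun z => (c z).1) u.
have th0 u : a < u < b -> th' u != 0.
  move=> uab; have Ju : `]a, b[%classic u by rewrite /= in_itv.
  pose i := chart_at NA (c u).
  have du : dom NA i (c u) by case: cs => /(_ u Ju).
  have [_ du2] := du.
  have [K K0 nK] := hbar_comparable Hc Hx du2.
  have [] // := @causal_velocity _ c i u K cs Ju du (cau _ uab _ du) K0.
  move=> v; have [|] // := nbhs_singleton nK (c u).1 _ v.
  by have [/= + _] := du; rewrite in_itv/= => /andP[/ltW -> /ltW ->].
have thc u : a < u < b -> {for u, continuous th'}.
  move=> uab; have Ju : `]a, b[%classic u by rewrite /= in_itv.
  pose i := chart_at NA (c u).
  have du : dom NA i (c u) by case: cs => /(_ u Ju).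
  have C := smooth_curve_velocity_continuous cs Ju du.
  have oJ : open (`]a, b[%classic : set R) by exact: interval_open.
  have nd : \forall z \near u, `]a, b[%classic z /\ dom NA i (c z).
    apply: filterI; first exact: (@near_open R _ u oJ Ju).
    have cu : c @ u --> c u := smooth_curve_continuous cs Ju.
    apply: (cu (dom NA i)); apply: (@near_open (R * M)%type (dom NA i) (c u)).
      exact: (cosmo_open_dom Hc).
    exact: du.
  have nE : \forall z \near u, (velocity (A:=NA) i c z).1 = th' z.
    by apply: filterS nd => z [Jz dz]; have [_ _ ->] := product_velocity cs Jz dz.
  change (th' @ u --> th' u); rewrite -(nbhs_singleton nE).
  apply: cvg_trans (near_eq_cvg nE) _.
  by apply: (@cvg_comp _ _ _ _ fst _ (nbhs (velocity (A:=NA) i c u))) => //; exact: cvg_fst.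
have same u v : a < u -> u <= v -> v < b -> (0 < th' u) = (0 < th' v).
  move=> au uv vb.
  apply: (@local_to_global_segment R u v (fun x y => (0 < th' x) = (0 < th' y))) => //.
    by move=> x y z _ _ _ _ -> ->.
  move=> x xuv; have xab : a < x < b by lra.
  have : \forall z \near x, `|th' x - th' z| < `|th' x|.
    by move/cvgrPdist_lt: (thc _ xab); apply; rewrite normr_gt0 th0.
  move=> /nbhs_ballP[d /= d0 Hd]; exists d => // y z _ _ _ yd zd.
  have sg y' : `|y' - x| < d -> (0 < th' y') = (0 < th' x).
    move=> y'd; have : `|th' x - th' y'| < `|th' x|.
      by apply: Hd; rewrite -ball_normE /= distrC.
    have := th0 _ xab; rewrite ltr_norml.
    case: (ltrgt0P (th' x)) => // sx _; rewrite ?(gtr0_norm sx) ?(ltr0_norm sx) => hh.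
      by apply/idP; lra.
    by apply/negbTE; rewrite -leNgt; lra.
  by rewrite !sg.
pose m := (a + b) / 2.
have mab : a < m < b by rewrite /m; lra.
have signs u : a < u < b -> (0 < th' u) = (0 < th' m).
  by move=> uab; have [um|mu] := leP u m; [apply: same|symmetry; apply: same]; lra.
have [pm|nm] := ltP 0 (th' m).
  by exists 1; rewrite normr1; split => // u uab; rewrite mul1r -/(th' u) signs.
exists (-1); rewrite normrN1; split => // u uab; rewrite mulN1r oppr_gt0.
rewrite lt_neqAle -/(th' u) th0//=.
by rewrite leNgt signs// -leNgt.
Qed.

End causal_curves.

Section causal_bound.
Context (R : realType) (n : nat) (M : topologicalType) (A : atlas 'rV[R]_n M)
  (tmax : R) (h : tensor2 (cosmo_atlas A tmax)) (hbar : R -> tensor2 A).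
Hypothesis Hc : cosmological_spacetime h.
Hypothesis Hx : extends_continuously h hbar.
Hypothesis cM : compact [set: M].
Let MA := cosmo_manifold Hc.
Let NA := cosmo_atlas A tmax.
Let g := cosmo_metric h.
Let dh := cosmo_null_dist h.
Let E := 'rV[R]_n.

Context (t0 : R).
Hypothesis t01 : 0 <= t0 <= tmax.
Let RT := slice_riemannian Hc Hx t01.
Let d := riem_dist (hbar t0).

Lemma riem_dist_small p (e : R) : 0 < e ->
  \forall q \near p, (d p q <= e%:E)%E /\ (d q p <= e%:E)%E.
Proof.
move=> e0; have dp := manifold_cover MA p.
have [K K0 [W nW HW]] := riem_dist_chart_le MA RT dp.
have eK : 0 < e / K by rewrite divr_gt0.
have nB := chart_ball_nbhs MA dp eK.
have Wp := nbhs_singleton nW.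
apply: filterS2 nW nB => q Wq [dq pq].
have Kpq : K * `|chart A (chart_at A p) p - chart A (chart_at A p) q| <= e.
  by move: pq; rewrite ltr_pdivlMr// mulrC => /ltW.
split; first by apply: le_trans (HW _ _ Wp Wq).2 _; rewrite lee_fin.
by apply: le_trans (HW _ _ Wq Wp).2 _; rewrite lee_fin distrC.
Qed.

(** The constants that the estimate along causal curves depends on, gathered so
    that compactness makes them uniform at once. *)
Definition causal_comparison (K : R) (p : M) := exists i W, [/\ open W, W p, 0 < K,
  forall x y, W x -> W y -> (d x y <= (K * `|chart A i x - chart A i y|)%:E)%E &
  forall x, W x -> dom A i x /\ forall t, 0 <= t <= tmax -> forall v : E,
    `|v| <= K * Num.sqrt (hbar t i x v v)].

Lemma causal_comparison_uniform : exists2 K : R, 0 < K & forall p, causal_comparison K p.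
Proof.
apply: compact_uniform_constant => // p.
have di := manifold_cover MA p; set i := chart_at A p in di.
have [K1 K10 [W1 nW1 H1]] := riem_dist_chart_le MA RT di.
have [K2 K20 nK2] := hbar_comparable Hc Hx di.
pose W := interior (W1 `&` [set q | dom A i q /\
  forall t, 0 <= t <= tmax -> forall v : E,
    `|v| <= K2 * Num.sqrt (hbar t i q v v)]).
have oW : open W by exact: open_interior.
have Wp : W p.
  apply: filterI => //; apply: filterI.
    exact: near_open (manifold_open_dom MA i) di.
  by apply: filterS nK2 => q H t tt v; have [] := H t tt v.
exists (K1 + K2); apply: filterS (near_open oW Wp) => q Wq K KK; exists i, W.
have sW := @interior_subset _ (W1 `&` [set q | dom A i q /\
  forall t, 0 <= t <= tmax -> forall v : E,
    `|v| <= K2 * Num.sqrt (hbar t i q v v)]).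
split=> //; first lra.
  move=> x y Wx Wy; have [W1x _] := sW _ Wx; have [W1y _] := sW _ Wy.
  apply: le_trans (H1 _ _ W1x W1y).2 _; rewrite lee_fin ler_wpM2r//; lra.
move=> x Wx; have [_ [dx bx]] := sW _ Wx; split => // t tt v.
by apply: le_trans (bx t tt v) _; rewrite ler_wpM2r ?sqrtr_ge0//; lra.
Qed.

(** Near a given parameter the curve stays in one chart, where each coordinate x_j
    of its projection has |x_j'| <= K |t'|.  Hence K t + x_j and K t - x_j, with t
    multiplied by its sign of variation, are nondecreasing, and the displacement in
    the chart is at most K times the variation of t.  As t is monotone, its
    variation is additive, so that these local bounds can be chained. *)
Lemma causal_segment_inner (K : R) (a b : R) c : 0 < K ->
  (forall p, causal_comparison K p) -> smooth_curve NA `]a, b[ c ->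
  (forall u, a < u < b -> forall i, dom NA i (c u) ->
     causal (g i (c u)) (velocity (A:=NA) i c u)) ->
  forall e : R, `|e| = 1 -> (forall u, a < u < b -> 0 < e * 'D_1 (fun z => (c z).1) u) ->
  forall v w, a < v -> v <= w -> w < b ->
  (d (c v).2 (c w).2 <= (K * K * (e * ((c w).1 - (c v).1)))%:E)%E.
Proof.
move=> K0 goodK cs cau e e1 mono v w av vw wb.
pose J : set R := `]a, b[%classic.
have oJ : open J by exact: interval_open.
have inJ u : a < u < b -> J u by rewrite /J /= in_itv.
apply: (@local_to_global_segment R v w
  (fun v w => (d (c v).2 (c w).2 <= (K * K * (e * ((c w).1 - (c v).1)))%:E)%E : Prop)) => //.
  move=> x y z _ _ _ _ xy yz.
  apply: le_trans (riem_dist_triangle MA RT _ (c y).2 _) _.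
  apply: le_trans (leeD xy yz) _.
  by rewrite -EFinD lee_fin -mulrDr -mulrDr [(c y).1 - _ + _]addrC addrA subrK.
move=> u uvw; have uab : a < u < b by lra.
have [i [W [oW Wu _ Wd Wdom]]] := goodK (c u).2.
have cu : c @ u --> c u := smooth_curve_continuous cs (inJ u uab).
have c2u : (fun z => (c z).2) @ u --> (c u).2.
  by apply: (@cvg_comp _ _ _ c snd _ (nbhs (c u))) => //; exact: cvg_snd.
have nW : \forall z \near u, J z /\ W (c z).2.
  apply: filterI; first exact: (@near_open R J u oJ (inJ u uab)).
  exact: (c2u _ (near_open oW Wu)).
have /nbhs_ballP[r /= r0 Hr] := nW.
exists r => // x y _ xy _ xr yr.
have xyP z : x <= z <= y -> a < z < b /\ W (c z).2.
  move=> xzy; have [] : J z /\ W (c z).2.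
    apply: Hr; rewrite -ball_normE /= distrC.
    by move: xr yr; rewrite !ltr_norml; lra.
  by rewrite /J /= in_itv.
have Wx : W (c x).2 by apply: (xyP x _).2; rewrite lexx.
have Wy : W (c y).2 by apply: (xyP y _).2; rewrite lexx andbT.
apply: le_trans (Wd _ _ Wx Wy) _; rewrite lee_fin -mulrA ler_pM2l//.
have dz z : x <= z <= y -> [/\ derivable (fun z => (c z).1) z 1,
   derivable (fun z => chart A i (c z).2) z 1 &
   `|'D_1 (fun z => chart A i (c z).2) z| <= K * (e * 'D_1 (fun z => (c z).1) z)].
  move=> /xyP[zab Wz]; have Jz := inJ _ zab.
  have [di bi] := Wdom _ Wz.
  have I1 : `]0, tmax[%classic (c z).1 by have [/(_ z Jz)[]] := cs.
  have dz : dom NA i (c z) by split.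
  have [D1 D2 _] := product_velocity cs Jz dz; split=> //.
  have t1 : 0 <= (c z).1 <= tmax by move: I1; rewrite /= in_itv/= => /andP[/ltW -> /ltW ->].
  have [_] := causal_velocity Hc Hx cs Jz dz (cau _ zab _ dz) K0 (bi _ t1).
  move/le_trans; apply; rewrite ler_pM2l//.
  have := mono _ zab; set th := derive _ _ _ => th0.
  by rewrite -[leRHS]gtr0_norm// normrM e1 mul1r.
(* Used below with plus or minus each coordinate, and with the zero function to
   get the sign of the right-hand side when the slice has dimension 0. *)
have key (f f' : R -> R) : (forall z, x <= z <= y -> is_derive z 1 f (f' z)) ->
    (forall z, x <= z <= y -> - f' z <= K * (e * 'D_1 (fun z => (c z).1) z)) ->
    f x - f y <= K * (e * ((c y).1 - (c x).1)).
  move=> Df bf.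
  pose F z := K * e * (c z).1 + f z.
  have dF z : x <= z <= y -> is_derive z 1 F (K * e * 'D_1 (fun z => (c z).1) z + f' z).
    move=> zxy; have [D1 _ _] := dz z zxy; have Dfz := Df z zxy.
    apply: (@is_deriveD _ _ _ (fun z => K * e * (c z).1) f).
    by apply: (@is_deriveZ _ _ _ (fun z => (c z).1)); exact: derivableP.
  have Fmono : F x <= F y.
    apply: (@ger0_derive1_ndecr _ F x y) => //.
    - by move=> z; rewrite in_itv/= => /andP[/ltW xz /ltW zy]; have [|] := dF z; rewrite ?xz.
    - move=> z; rewrite in_itv/= => /andP[/ltW xz /ltW zy].
      have zxy : x <= z <= y by rewrite xz.
      have D := dF z zxy; rewrite derive1E derive_val.
      by have := bf z zxy; rewrite mulrA; lra.
    - apply/subspace_continuousP => z /=; rewrite in_itv/= => zxy.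
      apply: cvg_within_filter; have D := dF z zxy.
      apply: differentiable_continuous; apply/derivable1_diffP; exact: ex_derive.
  by move: Fmono; rewrite /F; lra.
have entry j (s : R) : `|s| = 1 ->
    s * chart A i (c x).2 0 j - s * chart A i (c y).2 0 j <= K * (e * ((c y).1 - (c x).1)).
  move=> s1.
  apply: (key (fun z => s * chart A i (c z).2 0 j)
              (fun z => s * ('D_1 (fun z => chart A i (c z).2) z) 0 j)).
    move=> z zxy; have [_ D2 _] := dz z zxy.
    have Dj : derivable (fun z => chart A i (c z).2 0 j) z 1.
      exact: ((derivable_mxP _ _ _).1 D2 0 j).
    have -> : ('D_1 (fun z => chart A i (c z).2) z) 0 j = 'D_1 (fun z => chart A i (c z).2 0 j) z.
      by rewrite derive_mx// mxE.
    by apply: (@is_deriveZ _ _ _ (fun z => chart A i (c z).2 0 j)); exact: derivableP.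
  move=> z zxy; have [_ _ B] := dz z zxy; apply: le_trans B.
  apply: le_trans (row_norm_ge _ j).
  by apply: le_trans (ler_norm _) _; rewrite normrN normrM s1 mul1r.
apply: row_norm_le => [|j].
  have := key (fun=> 0) (fun=> 0); rewrite subrr; apply => z zxy.
  by rewrite oppr0; have [_ _] := dz z zxy; apply: le_trans.
rewrite !mxE ler_norml.
have := entry j 1 (normr1 _); have := entry j (-1) (normrN1 _); lra.
Qed.

(** A causal segment is smooth in the open interval only, and its velocity may be
    unbounded near the ends; the bound on inner intervals passes to the limit since
    both the distance and the time are continuous. *)
Lemma causal_segment_le (K : R) (a b : R) c : 0 < K ->
  (forall p, causal_comparison K p) -> a < b -> {within `[a, b], continuous c} ->
  smooth_curve NA `]a, b[ c ->
  (forall u, a < u < b -> forall i, dom NA i (c u) ->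
     causal (g i (c u)) (velocity (A:=NA) i c u)) ->
  (d (c a).2 (c b).2 <= (K * K * `|(c b).1 - (c a).1|)%:E)%E.
Proof.
move=> K0 goodK ab cc cs cau.
have [e [e1 mono]] := causal_time_monotone Hc Hx ab cs cau.
have inner := causal_segment_inner K0 goodK cs cau e1 mono.
apply/lee_addgt0Pr => eta eta0.
(* The constant k is such that the errors, at most 2 k in distance and 2 k in time,
   contribute eta in total. *)
pose k := eta / (2 * (K * K) + 2).
have KK : 0 < K * K by rewrite mulr_gt0.
have k0 : 0 < k by rewrite divr_gt0//; lra.
have near_end u : a <= u <= b -> exists2 r : R, 0 < r &
    forall z, a <= z <= b -> `|z - u| < r ->
    [/\ (d (c u).2 (c z).2 <= k%:E)%E, (d (c z).2 (c u).2 <= k%:E)%E &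
        `|(c u).1 - (c z).1| < k].
  move=> uab; have [|r r0 Hr] := @within_itv_near R a b _ c u
    [set q : R * M | ((d (c u).2 q.2 <= k%:E)%E /\ (d q.2 (c u).2 <= k%:E)%E) /\
                     `|(c u).1 - q.1| < k] cc uab.
    have c1 : fst @ nbhs (c u) --> (c u).1 by exact: cvg_fst.
    have c2 : snd @ nbhs (c u) --> (c u).2 by exact: cvg_snd.
    apply: filterI; first exact: (c2 _ (riem_dist_small (c u).2 k0)).
    apply: (c1 [set s | `|(c u).1 - s| < k]).
    by apply/nbhs_ballP; exists k => //= s; rewrite -ball_normE.
  by exists r => // z zab zr; have [[]] := Hr z zab zr.
have [|ra ra0 Ha] := near_end a; first by rewrite lexx ltW.
have [|rb rb0 Hb] := near_end b; first by rewrite lexx ltW.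
pose del := Num.min (Num.min ra rb) (b - a) / 3.
have del0 : 0 < del by rewrite divr_gt0// !lt_min ra0 rb0 subr_gt0.
have dra : del < ra.
  have : Num.min (Num.min ra rb) (b - a) <= ra by rewrite !ge_min lexx.
  by move: del0; rewrite /del; lra.
have drb : del < rb.
  have : Num.min (Num.min ra rb) (b - a) <= rb by rewrite !ge_min lexx orbT.
  by move: del0; rewrite /del; lra.
have dab : 3 * del <= b - a.
  have : Num.min (Num.min ra rb) (b - a) <= b - a by rewrite !ge_min lexx orbT.
  by rewrite /del; lra.
have [|| da _ ta] := Ha (a + del); [by lra|by rewrite addrAC subrr add0r gtr0_norm|].
have [|| _ db tb] := Hb (b - del); [by lra|by rewrite addrAC subrr add0r normrN gtr0_norm|].
have dm : (d (c (a + del)%R).2 (c (b - del)%R).2 <=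
    (K * K * (e * ((c (b - del)%R).1 - (c (a + del)%R).1)))%R%:E)%E by apply: inner; lra.
apply: le_trans (riem_dist_triangle MA RT _ (c (a + del)).2 _) _.
apply: le_trans (leeD da (riem_dist_triangle MA RT _ (c (b - del)).2 _)) _.
apply: le_trans (leeD (lexx _) (leeD dm db)) _.
rewrite -!EFinD lee_fin.
have te : e * ((c (b - del)).1 - (c (a + del)).1) <= `|(c b).1 - (c a).1| + (k + k).
  apply: le_trans (ler_norm _) _; rewrite normrM e1 mul1r.
  have -> : (c (b - del)).1 - (c (a + del)).1 =
     ((c b).1 - (c a).1) + (((c a).1 - (c (a + del)).1) - ((c b).1 - (c (b - del)).1)) by ring.
  apply: le_trans (ler_normD _ _) _; rewrite lerD2l.
  by apply: le_trans (ler_normB _ _) _; apply: lerD; exact: ltW.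
have : K * K * (e * ((c (b - del)).1 - (c (a + del)).1)) <=
    K * K * (`|(c b).1 - (c a).1| + (k + k)).
  by rewrite ler_pM2l.
have : k * (2 * (K * K) + 2) = eta by rewrite /k divfK// gt_eqF//; lra.
move: (K * K * _) => X; lra.
Qed.

(** Sum over the segments of a piecewise causal curve: its null length bounds
    the variation of time, and K^2 times its null length bounds the distance of the
    projections to the slice. *)
Lemma product_dist_le_null_dist : exists2 K : R, 0 < K & forall p q,
  (product_dist hbar t0 p q <= K%:E * dh p q)%E.
Proof.
have [K K0 goodK] := causal_comparison_uniform.
have KK : 0 < K * K by rewrite mulr_gt0.
exists (1 + K * K); first lra.
move=> p q; rewrite -lee_pdivrMl; last lra.
apply: le_ereal_inf_tmp => _ [a [b [m [s [c [[ps cin cc csm cau] <- <- ->]]]]]].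
rewrite lee_pdivrMl; last lra.
have [ab s0 sm lt_s] := ps.
suff H k : (k <= m)%N ->
    `|(c (s 0%N)).1 - (c (s k)).1| <=
      \sum_(j < k) `|(c (s j.+1)).1 - (c (s j)).1| /\
    (d (c (s 0%N)).2 (c (s k)).2 <=
      (K * K * \sum_(j < k) `|(c (s j.+1)).1 - (c (s j)).1|)%:E)%E.
  have [] := H m (leqnn _); rewrite s0 sm => H1 H2.
  rewrite /product_dist -EFinM mulrDl EFinD; apply: leeD; last exact: H2.
  by rewrite lee_fin mul1r.
elim: k => [_|k IH km].
  rewrite big_ord0 subrr normr0 mulr0; split=> //.
  apply/lee_addgt0Pr => e e0; rewrite add0e.
  by have [] := nbhs_singleton (riem_dist_small (c (s 0%N)).2 e0).
have [IH1 IH2] := IH (ltnW km).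
rewrite big_ord_recr /=; split.
  have -> : (c (s 0%N)).1 - (c (s k.+1)).1 =
    ((c (s 0%N)).1 - (c (s k)).1) - ((c (s k.+1)).1 - (c (s k)).1) by ring.
  by apply: le_trans (ler_normB _ _) _; rewrite lerD2r.
apply: le_trans (riem_dist_triangle MA RT _ (c (s k)).2 _) _.
rewrite mulrDr EFinD; apply: leeD => //.
apply: causal_segment_le => //; [exact: lt_s| |exact: csm|exact: cau].
apply: continuous_subspaceW cc; apply: subset_itvScc.
  by rewrite -s0; apply: (is_partition_ge ps); rewrite leq0n ltnW.
by rewrite -sm; apply: (is_partition_ge ps); rewrite km leqnn.
Qed.

End causal_bound.

(** * Completion of a dense part of a compact space *)

Section completion.
Context (R : realType) (Q : topologicalType) (Y N : set Q) (D dN : Q -> Q -> \bar R)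
  (K : R).
Hypothesis cY : compact Y.
Hypothesis NY : N `<=` Y.
Hypothesis D_ge0 : forall y z, (0 <= D y z)%E.
Hypothesis D_triangle : forall x y z, (D x z <= D x y + D y z)%E.
Hypothesis D_eq0 : forall y z, Y y -> Y z -> D y z = 0%E -> y = z.
Hypothesis D_small : forall y, Y y -> forall e : R, 0 < e ->
  \forall z \near y, (D y z <= e%:E)%E /\ (D z y <= e%:E)%E.
Hypothesis N_dense : forall y, Y y -> forall U, nbhs y U -> exists2 z, N z & U z.
Hypothesis K0 : 0 < K.
Hypothesis D_le : forall p q, N p -> N q -> (D p q <= K%:E * dN p q)%E.
Hypothesis dN_le : forall p q, N p -> N q -> (dN p q <= K%:E * D p q)%E.

Context (X : metricType R) (iota : Q -> X).
Hypothesis compl : is_completion N dN iota.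

Let KE0 : (0 <= K%:E)%E. Proof. by rewrite lee_fin ltW. Qed.

(** The graph of the identification of the completion X with the compact space Y:
    every neighbourhood of (x, y) contains a point of the image of N under
    p |-> (iota p, p). *)
Definition corresponds (x : X) (y : Q) := Y y /\ forall (e : R) (U : set Q),
  0 < e -> nbhs y U -> exists p, [/\ N p, mdist (iota p) x < e & U p].

Lemma D_refl y : Y y -> D y y = 0%E.
Proof.
move=> Yy; apply/eqP; rewrite eq_le D_ge0 andbT; apply/lee_addgt0Pr => e e0.
by rewrite add0e; have [] := nbhs_singleton (D_small Yy e0).
Qed.

(** Both inequalities hold on N and pass to the limit along points of N close to
    y and y' in Q whose images are close to x and x' in X. *)
Lemma corresponds_le x x' y y' : corresponds x y -> corresponds x' y' ->
  (D y y' <= K%:E * (mdist x x')%:E)%E /\ ((mdist x x')%:E <= K%:E * D y y')%E.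
Proof.
move=> [Yy xy] [Yy' xy'].
(* An error k e at each of the two points gives a total error at most e. *)
pose k (e : R) := e / (2 * K + 2).
have k0 e : 0 < e -> 0 < k e by move=> e0; rewrite divr_gt0//; have := K0; lra.
have kE e : 2 * k e + K * (2 * k e) = e.
  by rewrite /k; field; apply/eqP; have := K0; lra.
have pts e : 0 < e -> exists p p', [/\ N p, N p', mdist (iota p) x < e,
    mdist (iota p') x' < e & [/\ (D y p <= e%:E)%E, (D p y <= e%:E)%E,
    (D y' p' <= e%:E)%E & (D p' y' <= e%:E)%E]].
  move=> e0; have [p [Np xp [yp py]]] := xy e _ e0 (D_small Yy e0).
  have [p' [Np' xp' [yp' py']]] := xy' e _ e0 (D_small Yy' e0).
  by exists p, p'.
split; apply/lee_addgt0Pr => e e0.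
- have [p [p' [Np Np' xp xp' [yp _ _ py']]]] := pts _ (k0 e e0).
  apply: le_trans (D_triangle _ p _) _.
  apply: le_trans (leeD yp (D_triangle _ p' _)) _.
  apply: le_trans (leeD (lexx _) (leeD (D_le Np Np') py')) _.
  rewrite -(completion_isometry compl Np Np') -!EFinM -!EFinD lee_fin.
  have m1 : mdist (iota p) (iota p') <= mdist x x' + 2 * k e.
    apply: le_trans (metric_triangle _ x _) _.
    apply: le_trans (lerD (lexx _) (metric_triangle _ x' _)) _.
    rewrite (metric_sym x' _); lra.
  have : K * mdist (iota p) (iota p') <= K * (mdist x x' + 2 * k e) by rewrite ler_pM2l.
  rewrite mulrDr; have := kE e; lra.
- have [p [p' [Np Np' xp xp' [_ py yp' _]]]] := pts _ (k0 e e0).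
  have m1 : mdist x x' <= 2 * k e + mdist (iota p) (iota p').
    apply: le_trans (metric_triangle _ (iota p) _) _.
    apply: le_trans (lerD (lexx _) (metric_triangle _ (iota p') _)) _.
    rewrite (metric_sym x _); lra.
  apply: (@le_trans _ _ ((2 * k e)%:E + K%:E * D p p')%E).
    apply: (@le_trans _ _ (2 * k e + mdist (iota p) (iota p'))%:E); first by rewrite lee_fin.
    by rewrite EFinD (completion_isometry compl Np Np') leeD2l// dN_le.
  have d1 : (D p p' <= D y y' + (2 * k e)%:E)%E.
    apply: le_trans (D_triangle _ y _) _.
    apply: le_trans (leeD py (D_triangle _ y' _)) _.
    apply: le_trans (leeD (lexx _) (leeD (lexx _) yp')) _.
    rewrite addeCA -EFinD leeD2l// lee_fin; lra.
  apply: le_trans (leeD (lexx _) (lee_wpmul2l KE0 d1)) _.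
  have k2 : (0 <= (2 * k e)%:E)%E by rewrite lee_fin; have := k0 e e0; lra.
  by rewrite ge0_muleDr// addeCA -EFinM -EFinD kE.
Qed.

(** Take a cluster point in Y of the points of N whose image tends to x. *)
Lemma corresponds_total x : exists y, corresponds x y.
Proof.
pose F : set_system Q := [set U | exists2 e : R, 0 < e & forall p, N p ->
  mdist (iota p) x < e -> U p].
have appr e : 0 < e -> exists2 p, N p & mdist (iota p) x < e.
  move=> e0; have : closure (iota @` N) x by rewrite (completion_dense compl).
  move=> /(_ _ (nbhsx_ballx x e e0)) [_ [[p Np <-]]].
  by rewrite ballEmdist /= metric_sym => ?; exists p.
have FF : ProperFilter F.
  split; first by move=> [e e0 H]; have [p Np px] := appr e e0; exact: (H p).
  split.
  - by exists 1.
  - move=> U V [e e0 HU] [e' e0' HV]; exists (Num.min e e'); first by rewrite lt_min e0.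
    by move=> p Np; rewrite lt_min => /andP[h1 h2]; split; [exact: HU|exact: HV].
  - by move=> U V UV [e e0 HU]; exists e => // p Np px; apply: UV; exact: HU.
have FY : F Y by exists 1 => // p /NY.
have [y [Yy cl]] := cY FF FY.
exists y; split=> // e U e0 nU.
have FA : F [set p | N p /\ mdist (iota p) x < e] by exists e.
by have [p [[Np px] Up]] := cl _ _ FA nU; exists p.
Qed.

(** Points of N that tend to y form a Cauchy filter in X, because [dN] is at most
    K times [D]. *)
Lemma corresponds_surj y : Y y -> exists x, corresponds x y.
Proof.
move=> Yy.
pose F : set_system X :=
  [set V | exists2 U : set Q, nbhs y U & forall p, N p -> U p -> V (iota p)].
have FF : ProperFilter F.
  split; first by move=> [U nU H]; have [p Np Up] := N_dense Yy nU; exact: (H p).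
  split.
  - by exists setT => //; exact: filterT.
  - move=> V V' [U nU HU] [U' nU' HU']; exists (U `&` U'); first exact: filterI.
    by move=> p Np [Up Up']; split; [exact: HU|exact: HU'].
  - by move=> V V' VV [U nU HU]; exists U => // p Np Up; apply: VV; exact: HU.
have cF : cauchy F.
  apply: cauchy_exP => e e0.
  have e4 : 0 < e / (4 * K) by rewrite divr_gt0// mulr_gt0.
  have nU := D_small Yy e4.
  have [p0 Np0 [yp0 p0y]] := N_dense Yy nU.
  exists (iota p0); eexists; first exact: nU.
  move=> p Np [yp py]; rewrite ballEmdist /= -lte_fin (completion_isometry compl Np0 Np).
  apply: le_lt_trans (dN_le Np0 Np) _.
  apply: le_lt_trans (lee_wpmul2l KE0 (le_trans (D_triangle _ y _) (leeD p0y yp))) _.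
  rewrite -EFinD -EFinM lte_fin.
  have -> : K * (e / (4 * K) + e / (4 * K)) = e / 2 by field; rewrite gt_eqF.
  lra.
have [x Fx] := completion_complete compl FF cF.
exists x; split=> // e U e0 nU.
have [U' nU' HU'] := Fx _ (nbhsx_ballx x e e0).
have [p Np [Up Up']] := N_dense Yy (filterI nU nU').
by exists p; split=> //; have := HU' p Np Up'; rewrite ballEmdist /= metric_sym.
Qed.

Lemma corresponds_uniq x y y' : corresponds x y -> corresponds x y' -> y = y'.
Proof.
move=> c c'; have [+ _] := corresponds_le c c'; rewrite mdistxx mule0 => d0.
by apply: D_eq0 (c.1) (c'.1) _; apply/eqP; rewrite eq_le d0 D_ge0.
Qed.

Lemma corresponds_inj x x' y : corresponds x y -> corresponds x' y -> x = x'.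
Proof.
move=> c c'; have [_] := corresponds_le c c'; rewrite D_refl ?mule0; last exact: c.1.
by rewrite lee_fin => d0; apply: mdist_positivity; apply/eqP; rewrite eq_le d0 mdist_ge0.
Qed.

Lemma completion_bilipschitz_equivalent : bilipschitz_equivalent X Y D.
Proof.
have [f Hf] := choice corresponds_total.
exists f, K; split=> //; last by move=> x x'; exact: corresponds_le.
split.
- by move=> x _; exact: (Hf x).1.
- by move=> x x' _ _ ff; apply: corresponds_inj (Hf x) _; rewrite ff.
- move=> y Yy; have [x xy] := corresponds_surj Yy; exists x => //.
  exact: corresponds_uniq (Hf x) xy.
Qed.

(** X is the image of the compact space Y under the inverse identification, which is
    continuous. *)
Lemma completion_compact : compact [set: X].
Proof.
have [->|/set0P[x0 _]] := eqVneq [set: X] set0; first exact: compact0.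
have ex_x y : exists x, Y y -> corresponds x y.
  have [Yy|nY] := pselect (Y y); last by exists x0.
  by have [x xy] := corresponds_surj Yy; exists x.
have [gg Hg] := choice ex_x.
have -> : [set: X] = gg @` Y.
  apply/seteqP; split=> // x _; have [y xy] := corresponds_total x.
  by exists y; [exact: xy.1|exact: corresponds_inj (Hg _ xy.1) xy].
apply: continuous_compact cY; apply/subspace_continuousP => y Yy.
apply/metricType_numDomainType.cvgrPdist_lt => e e0.
have e2 : 0 < e / (2 * K) by rewrite divr_gt0// mulr_gt0.
have nD := D_small Yy e2.
apply: filterS nD => z [yz _] Yz.
rewrite -lte_fin; have [_] := corresponds_le (Hg _ Yy) (Hg _ Yz).
move/le_lt_trans; apply; apply: le_lt_trans (lee_wpmul2l KE0 yz) _.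
rewrite -EFinM lte_fin.
have -> : K * (e / (2 * K)) = e / 2 by field; rewrite gt_eqF.
lra.
Qed.

End completion.

(** * The product distance on the closed slab *)

Section product_distance.
Context (R : realType) (n : nat) (M : topologicalType) (A : atlas 'rV[R]_n M)
  (tmax : R) (h : tensor2 (cosmo_atlas A tmax)) (hbar : R -> tensor2 A).
Hypothesis Hc : cosmological_spacetime h.
Hypothesis Hx : extends_continuously h hbar.
Hypothesis cM : compact [set: M].
Let MA := cosmo_manifold Hc.
Let T0 := cosmo_tmax Hc.
Context (t0 : R).
Hypothesis t01 : 0 <= t0 <= tmax.
Let RT := slice_riemannian Hc Hx t01.
Let D := product_dist hbar t0.
Let dh := cosmo_null_dist h.

(** M is the image of the connected spacetime under the projection. *)
Lemma slice_connected : connected [set: M].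
Proof.
have -> : [set: M] = snd @` cosmo_space M tmax.
  apply/seteqP; split=> // x _; exists (tmax / 2, x) => //; split => //=.
  by rewrite in_itv /=; have := T0; lra.
apply: connected_continuous_connected (cosmo_connected Hc) _.
by apply: continuous_subspaceT => p; exact: cvg_snd.
Qed.

Lemma product_dist_ge0 p q : (0 <= D p q)%E.
Proof. by apply: adde_ge0; [rewrite lee_fin|exact: riem_dist_ge0]. Qed.

Lemma product_dist_triangle p q r : (D p r <= D p q + D q r)%E.
Proof.
rewrite /D /product_dist addeACA; apply: leeD; last exact: riem_dist_triangle.
by rewrite -EFinD lee_fin ler_distD.
Qed.

Lemma product_dist_small p (e : R) : 0 < e ->
  \forall q \near p, (D p q <= e%:E)%E /\ (D q p <= e%:E)%E.
Proof.
move=> e0; have e2 : 0 < e / 2 by rewrite divr_gt0.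
have c1 : fst @ nbhs p --> p.1 by exact: cvg_fst.
have c2 : snd @ nbhs p --> p.2 by exact: cvg_snd.
have n2 : \forall q \near p, (riem_dist (hbar t0) p.2 q.2 <= (e / 2)%:E)%E /\
    (riem_dist (hbar t0) q.2 p.2 <= (e / 2)%:E)%E.
  exact: (c2 _ (riem_dist_small Hc Hx t01 p.2 e2)).
have n1 : \forall q \near p, `|p.1 - q.1| < e / 2.
  apply: (c1 [set s | `|p.1 - s| < e / 2]).
  by apply/nbhs_ballP; exists (e / 2) => //= s; rewrite -ball_normE.
apply: filterS2 n1 n2 => q q1 [q2 q2'].
rewrite /D /product_dist (splitr e) EFinD; split; apply: leeD => //; rewrite lee_fin ltW//.
by rewrite distrC.
Qed.

Lemma product_dist_refl p : D p p = 0%E.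
Proof.
apply/eqP; rewrite eq_le product_dist_ge0 andbT; apply/lee_addgt0Pr => e e0.
by rewrite add0e; have [] := nbhs_singleton (product_dist_small p e0).
Qed.

Lemma product_dist_eq0 p q : D p q = 0%E -> p = q.
Proof.
case: p q => [t x] [s y] /eqP; rewrite /D /product_dist /=.
rewrite padde_eq0; [|by rewrite lee_fin|exact: riem_dist_ge0].
move=> /andP[]; rewrite eqe normr_eq0 subr_eq0 => /eqP -> /eqP d0.
by rewrite (riem_dist_eq0 MA RT cM d0).
Qed.

Lemma product_dist_lty p q : (D p q < +oo)%E.
Proof.
by apply: lte_add_pinfty; [exact: ltry|exact: riem_dist_lty MA RT slice_connected _ _].
Qed.

Lemma product_dist_equivalent : exists2 K : R, 0 < K & forall p q,
  cosmo_space M tmax p -> cosmo_space M tmax q ->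
  (D p q <= K%:E * dh p q)%E /\ (dh p q <= K%:E * D p q)%E.
Proof.
have [K1 K10 H1] := product_dist_le_null_dist Hc Hx cM t01.
have [K2 K20 H2] := cosmo_null_dist_le Hc Hx cM t01.
exists (K1 + K2); first lra.
move=> p q Np Nq; split.
  apply: le_trans (H1 p q) _; apply: lee_wpmul2r; first exact: cosmo_null_dist_ge0.
  by rewrite lee_fin; lra.
apply: le_trans (H2 p q Np Nq) _; apply: lee_wpmul2r; first exact: product_dist_ge0.
by rewrite lee_fin; lra.
Qed.

Lemma cosmo_space_dense p U : (`[0, tmax] `*` [set: M]) p -> nbhs p U ->
  exists2 q, cosmo_space M tmax q & U q.
Proof.
case: p => t x [/= t1 _] [[V1 V2] /= [nV1 nV2] VU]; rewrite in_itv/= in t1.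
suff [s s1 Vs] : exists2 s, 0 < s < tmax & V1 s.
  exists (s, x); first by split => //=; rewrite in_itv.
  by apply: VU; split => //=; exact: nbhs_singleton nV2.
have /nbhs_ballP[r /= r0 Hr] := nV1.
have T0' := T0.
have [tT|tT] := ltP t tmax.
  pose m := Num.min r (tmax - t).
  have m1 : m <= r by rewrite ge_min lexx.
  have m2 : m <= tmax - t by rewrite ge_min lexx orbT.
  have m0 : 0 < m by rewrite lt_min r0 subr_gt0.
  exists (t + m / 2); first lra.
  by apply: Hr; rewrite -ball_normE /= opprD addNKr normrN gtr0_norm; lra.
pose m := Num.min r tmax.
have m1 : m <= r by rewrite ge_min lexx.
have m2 : m <= tmax by rewrite ge_min lexx orbT.
have m0 : 0 < m by rewrite lt_min r0.
exists (t - m / 2); first lra.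
by apply: Hr; rewrite -ball_normE /= subKr gtr0_norm; lra.
Qed.

End product_distance.

Theorem theorem1p1 (R : realType) (n : nat) (M : topologicalType)
    (A : atlas 'rV[R]_n M) (tmax : R) (h : tensor2 (cosmo_atlas A tmax))
    (hbar : R -> tensor2 A) :
  cosmological_spacetime h ->
  compact [set: M] ->
  extends_continuously h hbar ->
  is_metric_on (cosmo_space M tmax) (cosmo_null_dist h) /\
  forall (X : metricType R) (iota : R * M -> X),
    is_completion (cosmo_space M tmax) (cosmo_null_dist h) iota ->
    compact [set: X] /\
    forall t0 : R, 0 <= t0 <= tmax ->
      bilipschitz_equivalent X (`[0, tmax] `*` [set: M])
        (product_dist hbar t0).
Proof.
move=> Hc cM Hx; have T0 := cosmo_tmax Hc.
split.
  have t01 : 0 <= (0 : R) <= tmax by rewrite lexx ltW.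
  have [K K0 HK] := product_dist_equivalent Hc Hx cM t01.
  split.
  - move=> p q Np Nq; rewrite ge0_fin_numE; last exact: null_dist_ge0.
    have [_ /le_lt_trans] := HK p q Np Nq; apply.
    by rewrite lte_mul_pinfty ?lee_fin ?ltW//; exact: (product_dist_lty Hc Hx t01).
  - by move=> p q _ _; exact: null_dist_ge0.
  - move=> p q Np Nq; split=> [d0|<-].
      apply: (product_dist_eq0 Hc Hx cM t01); apply/eqP.
      rewrite eq_le product_dist_ge0 andbT.
      by have [+ _] := HK p q Np Nq; rewrite d0 mule0.
    apply/eqP; rewrite eq_le null_dist_ge0 andbT.
    by have [_] := HK p p Np Np; rewrite (product_dist_refl Hc Hx t01) mule0.
  - by move=> p q _ _; exact: (cosmo_null_dist_sym Hc).
  - by move=> p q r _ _ _; exact: (cosmo_null_dist_triangle Hc).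
move=> X iota compl.
have NY : cosmo_space M tmax `<=` `[0, tmax]%classic `*` [set: M].
  move=> [t x] [/= + _]; rewrite !in_itv/= => /andP[/ltW a /ltW b].
  by split => //=; rewrite a b.
have cY : compact (`[0, tmax]%classic `*` [set: M]).
  by apply: compact_setX => //; exact: segment_compact.
have both t0 : 0 <= t0 <= tmax -> compact [set: X] /\
    bilipschitz_equivalent X (`[0, tmax] `*` [set: M]) (product_dist hbar t0).
  move=> t01; have [K K0 HK] := product_dist_equivalent Hc Hx cM t01.
  have D0 := product_dist_ge0 hbar t0.
  have D3 := product_dist_triangle Hc Hx t01.
  have De p (_ : (`[0, tmax]%classic `*` [set: M]) p) := product_dist_small Hc Hx t01 p.
  have H1 p q Np Nq := (HK p q Np Nq).1.
  have H2 p q Np Nq := (HK p q Np Nq).2.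
  have dense p Yp U := @cosmo_space_dense _ _ _ _ _ _ Hc p U Yp.
  split; first exact: (completion_compact cY NY D0 D3 De dense K0 H1 H2 compl).
  apply: (completion_bilipschitz_equivalent cY NY D0 D3 _ De dense K0 H1 H2 compl).
  by move=> p q _ _; exact: (product_dist_eq0 Hc Hx cM t01).
split=> [|t0 t01]; last exact: (both t0 t01).2.
by apply: (both 0 _).1; rewrite lexx ltW.
Qed.
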